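(* For a general Humbert sextic K3 surface $X=\mathfrak{G}\cap R$ (i.e., for $R$ in a nonempty Zariski open subset of the space of hyperplanes of $\mathbb{P}^5$), the subgroup of $\operatorname{Aut}(R)\cong\operatorname{Aut}(\mathbb{P}^4)$ consisting of projective automorphisms leaving $X$ invariant is trivial.
   Context: In $\mathbb{P}^5$ with coordinates $(x_1,x_2,x_3,y_1,y_2,y_3)$, the Humbert cubic line complex is $\mathfrak{G}=V(Q,F)$ with $Q=x_1^2+x_2^2+x_3^2+y_1^2+y_2^2+y_3^2$ and $F=x_1x_2x_3+\sqrt{-1}\,y_1y_2y_3$. A Humbert sextic K3 surface is $X=\mathfrak{G}\cap R$ for a hyperplane $R\subset\mathbb{P}^5$ transversal to $\mathfrak{G}$; it is a smooth K3 surface of degree $6$ in $R\cong\mathbb{P}^4$. *)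

(* Defs.v *)
From mathcomp Require Import all_boot all_order all_algebra.
From mathcomp Require Import mpoly.
Set Implicit Arguments. Unset Strict Implicit. Unset Printing Implicit Defensive.
Import Order.TTheory GRing.Theory Num.Theory.
Local Open Scope ring_scope.

(* Points of C^6 are column vectors v : 'cV[C]_6, coordinates
   (x1,x2,x3,y1,y2,y3) = (v 0 0, v 1 0, v 2 0, v 3 0, v 4 0, v 5 0). *)
Section Humbert.
Variable C : numClosedFieldType.

Definition coord (v : 'cV[C]_6) (k : nat) : C := v (inord k) 0.

Definition humbertQ (v : 'cV[C]_6) : C := \sum_(i < 6) v i 0 ^+ 2.

Definition humbertF (v : 'cV[C]_6) : C :=
  coord v 0 * coord v 1 * coord v 2 + 'i * (coord v 3 * coord v 4 * coord v 5).

(* the (affine cone over the) hyperplane R_c = { sum_i c_i v_i = 0 } *)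
Definition in_hyperplane (c : 'rV[C]_6) (v : 'cV[C]_6) : bool :=
  \sum_(i < 6) c 0 i * v i 0 == 0.

(* the (affine cone over the) surface X_c = G ∩ R_c = V(Q, F, c) *)
Definition in_humbertX (c : 'rV[C]_6) (v : 'cV[C]_6) : bool :=
  [&& in_hyperplane c v, humbertQ v == 0 & humbertF v == 0].

(* A linear automorphism A of C^6 preserving the hyperplane R_c; its
   restriction to R_c is an arbitrary element of GL(R_c), and every element
   of Aut(R_c) = PGL(R_c) arises this way. *)
Definition preserves_hyperplane (c : 'rV[C]_6) (A : 'M[C]_6) : Prop :=
  A \in unitmx /\ forall v, in_hyperplane c v -> in_hyperplane c (A *m v).

Definition leaves_X_invariant (c : 'rV[C]_6) (A : 'M[C]_6) : Prop :=
  forall v, in_hyperplane c v -> in_humbertX c (A *m v) = in_humbertX c v.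

(* the induced projective automorphism of P(R_c) is the identity *)
Definition trivial_on_hyperplane (c : 'rV[C]_6) (A : 'M[C]_6) : Prop :=
  exists lam : C, forall v, in_hyperplane c v -> A *m v = lam *: v.

End Humbert.

(* Main.v *)
Require Import Defs.
From mathcomp Require Import all_boot all_order all_algebra.
From mathcomp Require Import mpoly.
From mathcomp Require Import ring zify ssrZ.
Import Order.TTheory GRing.Theory Num.Theory.
Local Open Scope ring_scope.
Set Implicit Arguments. Unset Strict Implicit. Unset Printing Implicit Defensive.
Local Notation coord := Defs.coord.

(* For general c the surface X_c contains exactly 24 lines, the traces on R_c
   of the planes x_k = eps_k 'i y_(sigma k) with sigma a permutation and
   eps_0 eps_1 eps_2 = 1; an automorphism permutes them and preserves their
   incidence graph.  Each line meets six others, in three pairs of points cut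
   out by y_(sigma a)^2 = y_(sigma b)^2, and the graph determines the pairs.  The
   three quadratic forms sum to zero on the line, so they are transported up to
   one common scalar, and the ratios of their discriminants are invariants of
   the line: they are the ratios of the d_k^2, where sum_k d_k y_(sigma k) = 0 is
   the equation of the line.  For general c these ratios are pairwise distinct,
   hence every line is mapped to itself and every incidence point is fixed; so
   the automorphism is a scalar on each line, the same scalar for all lines as
   the graph is connected, and the lines span R_c. *)

(** * The incidence graph of the 24 lines *)

(** The automorphism is given only as a linear map respecting X, not as a symmetry of the two
    equations, so everything about it must be read off from the lines; that the list of lines is
    complete is what makes them permuted. Two lines meet when their permutations differ by a
    transposition and they share the equation x_k = eps_k 'i y_m at its fixed place k, the kind of
    the incidence. Planes with the same permutation share one sign and meet only in a node of V(Q,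
    F), which R_c avoids; hence the last clause of [adjk]. Two neighbours of different kinds have
    distinct permutations of equal parity. Each of the three permutations of the other parity then
    has its signs prescribed at two places and gives one common neighbour, three in all. This lets a
    graph automorphism see the kinds. The graph alone has nontrivial automorphisms, so the
    discriminant ratios are indispensable for fixing the lines. That the genericity conditions
    define a nonempty open set is shown by one explicit hyperplane with integer coordinates. *)

(* The index [v < 24] encodes a plane x_k = 'i * eps_k * y_(sigma k) contained
   in V(Q, F): [v %/ 4] selects sigma, the two low bits of [v] the signs
   (true meaning -1), subject to eps_0 * eps_1 * eps_2 = 1. *)
Definition perm3 : seq (seq nat) :=
  [:: [:: 0; 1; 2]; [:: 0; 2; 1]; [:: 1; 0; 2];
      [:: 1; 2; 0]; [:: 2; 0; 1]; [:: 2; 1; 0]]%N.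
Definition sig (v k : nat) : nat := nth 0%N (nth [::] perm3 (v %/ 4)) k.
Definition neg (v k : nat) : bool :=
  match k with
  | 0 => odd v
  | 1 => odd v./2
  | _ => odd v (+) odd v./2
  end.

Definition adjk (k v u : nat) : bool :=
  [&& sig v k == sig u k, neg v k == neg u k & v %/ 4 != u %/ 4]%N.
Definition adj (v u : nat) : bool := has (fun k => adjk k v u) (iota 0 3).
Definition kind (v u : nat) : nat := find (fun k => adjk k v u) (iota 0 3).
Definition common (v u : nat) : nat :=
  count (fun w => adj w v && adj w u) (iota 0 24).

Lemma all_iotaP (n : nat) (P : pred nat) :
  all P (iota 0 n) -> forall k, (k < n)%N -> P k.
Proof. by move=> /allP h k kn; apply: h; rewrite mem_iota. Qed.

Lemma all_iota2P (m n : nat) (P : nat -> pred nat) :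
  all (fun k => all (P k) (iota 0 n)) (iota 0 m) ->
  forall k l, (k < m)%N -> (l < n)%N -> P k l.
Proof. by move=> /all_iotaP h k l /h /all_iotaP; apply. Qed.

Lemma all_iota3P (m n p : nat) (P : nat -> nat -> pred nat) :
  all (fun k => all (fun l => all (P k l) (iota 0 p)) (iota 0 n)) (iota 0 m) ->
  forall k l j, (k < m)%N -> (l < n)%N -> (j < p)%N -> P k l j.
Proof. by move=> /all_iota2P h k l j km ln; apply/all_iotaP/h. Qed.

Lemma adjk_kind (k v u : nat) :
  (k < 3)%N -> (v < 24)%N -> (u < 24)%N -> adjk k v u -> kind v u = k.
Proof.
have /all_iota3P h : all (fun k => all (fun v => all (fun u =>
  adjk k v u ==> (kind v u == k)) (iota 0 24)) (iota 0 24)) (iota 0 3).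
  by vm_compute.
by move=> k3 v24 u24 vu; apply/eqP/(implyP (h _ _ _ k3 v24 u24)).
Qed.

Lemma adj_kind (v u : nat) :
  adj v u -> (kind v u < 3)%N /\ adjk (kind v u) v u.
Proof.
rewrite /adj has_find size_iota -/(kind v u) => lt3; split=> //.
have := @nth_find _ 0%N (fun k => adjk k v u) (iota 0 3).
by rewrite has_find size_iota -/(kind v u) lt3 nth_iota // add0n; apply.
Qed.

Lemma adjk_adj (k v u : nat) : (k < 3)%N -> adjk k v u -> adj v u.
Proof. by move=> k3 vu; apply/hasP; exists k; rewrite ?mem_iota. Qed.

Lemma adjk_ex (k v : nat) :
  (k < 3)%N -> (v < 24)%N -> exists2 u, (u < 24)%N & adjk k v u.
Proof.
have /all_iota2P h : all (fun k => all (fun v => has (adjk k v) (iota 0 24))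
  (iota 0 24)) (iota 0 3) by vm_compute.
move=> k3 v24; have /hasP[u] := h _ _ k3 v24.
by rewrite mem_iota; exists u.
Qed.

(* Hence the graph [adj] alone tells which neighbours of [v] are of the same
   kind: those with two common neighbours. *)
Lemma common_kind (v u w : nat) :
  (v < 24)%N -> (u < 24)%N -> (w < 24)%N -> adj v u -> adj v w ->
  (common u w == 3%N) = (kind v u != kind v w).
Proof.
have /all_iota3P h : all (fun v => all (fun u => all (fun w =>
     if adj v u then if adj v w then
       (common u w == 3%N) == (kind v u != kind v w) else true else true)
   (iota 0 24)) (iota 0 24)) (iota 0 24) by vm_compute.
move=> v24 u24 w24 vu vw.
by have := h _ _ _ v24 u24 w24; rewrite vu vw => /eqP.
Qed.

Lemma commonE (v u : nat) :
  common v u = #|[set w : 'I_24 | adj w v && adj w u]|.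
Proof.
rewrite cardE /enum_mem size_filter -enumT /common -val_enum_ord count_map.
by apply: eq_count => w; rewrite /= inE.
Qed.

Lemma common_aut (pi : 'I_24 -> 'I_24) :
  injective pi -> (forall v u, adj (pi v) (pi u) = adj v u) ->
  forall v u : 'I_24, common (pi v) (pi u) = common v u.
Proof.
move=> inj_pi adj_pi v u; rewrite !commonE -[RHS](card_imset _ inj_pi).
apply: eq_card => w; rewrite inE; apply/idP/imsetP => [h|[z]].
  exists (iinv (injF_onto inj_pi w)); last by rewrite f_iinv.
  by rewrite inE -(adj_pi _ v) -(adj_pi _ u) f_iinv.
by rewrite inE => h ->; rewrite !adj_pi.
Qed.

(** Kinds of two neighbours of [v] are compared by counting common neighbours, a number preserved by
    [pi]. So [pi] carries the three pairs of neighbours at [v] to those at [pi v]; the bijection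
    [theta] of kinds depends on [v]. *)
Lemma kind_aut (pi : 'I_24 -> 'I_24) :
  injective pi -> (forall v u, adj (pi v) (pi u) = adj v u) ->
  forall v : 'I_24, exists theta : nat -> nat,
  [/\ forall k, (k < 3)%N -> (theta k < 3)%N,
      forall k l, (k < 3)%N -> (l < 3)%N -> theta k = theta l -> k = l &
      forall k (u : 'I_24), (k < 3)%N -> adjk k v u ->
        adjk (theta k) (pi v) (pi u)].
Proof.
move=> inj_pi adj_pi v.
have kindE (u w : 'I_24) : adj v u -> adj v w ->
    (kind (pi v) (pi u) == kind (pi v) (pi w)) = (kind v u == kind v w).
  move=> vu vw; apply: negb_inj.
  by rewrite -!common_kind ?adj_pi // common_aut.
have nb k : (k < 3)%N -> exists u : 'I_24, adjk k v u.
  by move=> k3; have [u u24 vu] := adjk_ex k3 (ltn_ord v); exists (Ordinal u24).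
pose nbr k := odflt v [pick u : 'I_24 | adjk k v u].
have nbrP k : (k < 3)%N -> adjk k v (nbr k).
  move=> k3; rewrite /nbr; case: pickP => //= no.
  by have [u] := nb k k3; rewrite no.
have nbrA k : (k < 3)%N -> adj v (nbr k) by move=> k3; apply/(adjk_adj k3)/nbrP.
exists (fun k => kind (pi v) (pi (nbr k))); split.
- by move=> k k3; apply: (proj1 (adj_kind _)); rewrite adj_pi nbrA.
- move=> k l k3 l3 /eqP; rewrite kindE ?nbrA // => /eqP.
  by rewrite (adjk_kind k3) ?(adjk_kind l3) ?nbrP.
- move=> k u k3 vu; have vu' := adjk_adj k3 vu.
  suff /eqP -> : kind (pi v) (pi (nbr k)) == kind (pi v) (pi u).
    by apply: (proj2 (adj_kind _)); rewrite adj_pi.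
  by rewrite kindE ?nbrA // !(adjk_kind k3) ?nbrP.
Qed.

Lemma adj_connected (T : Type) (f : 'I_24 -> T) :
  (forall v u : 'I_24, adj v u -> f v = f u) -> forall v u, f v = f u.
Proof.
move=> fadj.
pose step (s : seq nat) :=
  [seq u <- iota 0 24 | has (fun w => (w == u) || adj w u) s].
have reach n u : u \in iter n step [:: 0%N] ->
    exists u24 : (u < 24)%N, f (Ordinal u24) = f ord0.
  elim: n u => [|n IHn] u /=.
    by rewrite inE => /eqP ->; exists isT; congr f; apply: val_inj.
  rewrite mem_filter mem_iota /= add0n => /andP[/hasP[w /IHn[w24 fw] wu] u24].
  exists u24; rewrite -fw; case/orP: wu => [/eqP wu|wu].
    by congr f; apply: val_inj.
  by apply/esym/fadj.
have /allP h : all (fun v => v \in iter 4 step [:: 0%N]) (iota 0 24).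
  by vm_compute.
suff f0 (v : 'I_24) : f v = f ord0 by move=> v u; rewrite !f0.
have /reach[v24 <-] : val v \in iter 4 step [:: 0%N].
  by apply: h; rewrite mem_iota /= ltn_ord.
by congr f; apply: val_inj.
Qed.

(** * The genericity polynomial *)

(* [(k, m, b)] stands for the hyperplane x_k = (-1)^b 'i y_m. *)
Definition label : Type := (nat * nat * bool)%type.
Definition labels : seq label :=
  [seq (km.1, km.2, b) | km <- [seq (k, m) | k <- iota 0 3, m <- iota 0 3],
                         b <- [:: false; true]].
Definition lab (v k : nat) : label := (k, sig v k, neg v k).

Lemma labels_lt (k m : nat) (b : bool) :
  (k, m, b) \in labels -> (k < 3)%N /\ (m < 3)%N.
Proof.
have /allP h : all (fun p => (p.1.1 < 3) && (p.1.2 < 3))%N labels by vm_compute.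
by move=> /h/andP.
Qed.

Lemma lab_in (v k : nat) : (v < 24)%N -> (k < 3)%N -> lab v k \in labels.
Proof.
have /all_iota2P h : all (fun v => all (fun k => lab v k \in labels) (iota 0 3))
  (iota 0 24) by vm_compute.
exact: h.
Qed.

Section Generic.
Variable C : numClosedFieldType.

(** The coefficient of y_m left in the equation of R_c by the substitution x_k = (-1)^b 'i y_m. It
    is also the value of that equation at the node whose only nonzero coordinates are x_k and
    y_m. *)
Definition dlab (c : 'rV[C]_6) (p : label) : C :=
  c 0 (inord (3 + p.1.2)) + (-1) ^+ p.2 * 'i * c 0 (inord p.1.1).

(* The four families say in turn: R_c avoids the 18 nodes x_k^2 + y_m^2 = 0 of
   V(Q, F); it cuts each of the nine quadric surfaces x_k = y_m = 0 in a smooth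
   conic; it avoids the remaining 16 nodes; the moduli of the six marked points
   on the 24 lines are pairwise different. *)
Definition generic (c : 'rV[C]_6) : Prop :=
  [/\ forall p, p \in labels -> dlab c p != 0,
      forall k m, (k < 3)%N -> (m < 3)%N ->
        \sum_i c 0 i ^+ 2 - c 0 (inord k) ^+ 2 - c 0 (inord (3 + m)) ^+ 2 != 0,
      forall v (s t : bool), (v < 24)%N ->
        dlab c (lab v 0) + (-1) ^+ s * dlab c (lab v 1)
        + (-1) ^+ t * dlab c (lab v 2) != 0 &
      forall p q p' q', p \in labels -> q \in labels -> p' \in labels ->
        q' \in labels -> p != q -> (p, q) != (p', q') ->
        dlab c p ^+ 2 * dlab c q' ^+ 2 != dlab c p' ^+ 2 * dlab c q ^+ 2].

Definition dlabP (p : label) : {mpoly C[6]} :=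
  'X_(inord (3 + p.1.2)) + ((-1) ^+ p.2 * 'i) *: 'X_(inord p.1.1).

Definition squaresP (k m : nat) : {mpoly C[6]} :=
  \sum_i 'X_i ^+ 2 - 'X_(inord k) ^+ 2 - 'X_(inord (3 + m)) ^+ 2.

Definition nodeP (v : nat) (s t : bool) : {mpoly C[6]} :=
  dlabP (lab v 0) + (-1) ^+ s *: dlabP (lab v 1) + (-1) ^+ t *: dlabP (lab v 2).

Definition ratioP (p q p' q' : label) : {mpoly C[6]} :=
  dlabP p ^+ 2 * dlabP q' ^+ 2 - dlabP p' ^+ 2 * dlabP q ^+ 2.

Lemma dlabPE (c : 'rV[C]_6) p : (dlabP p).@[fun i => c 0 i] = dlab c p.
Proof. by rewrite mevalD mevalZ !mevalXU. Qed.

Lemma squaresPE (c : 'rV[C]_6) k m : (squaresP k m).@[fun i => c 0 i] =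
  \sum_i c 0 i ^+ 2 - c 0 (inord k) ^+ 2 - c 0 (inord (3 + m)) ^+ 2.
Proof.
rewrite 2!mevalB raddf_sum /= !rmorphXn /= !mevalXU.
by congr (_ - _ - _); apply: eq_bigr => i _; rewrite rmorphXn /= mevalXU.
Qed.

Lemma nodePE (c : 'rV[C]_6) v s t : (nodeP v s t).@[fun i => c 0 i] =
  dlab c (lab v 0) + (-1) ^+ s * dlab c (lab v 1) + (-1) ^+ t * dlab c (lab v 2).
Proof. by rewrite 2!mevalD !mevalZ !dlabPE. Qed.

Lemma ratioPE (c : 'rV[C]_6) p q p' q' : (ratioP p q p' q').@[fun i => c 0 i] =
  dlab c p ^+ 2 * dlab c q' ^+ 2 - dlab c p' ^+ 2 * dlab c q ^+ 2.
Proof. by rewrite mevalB !mevalM !dlabPE. Qed.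

Lemma dlabP_homog p : dlabP p \is 1.-homog.
Proof. by rewrite rpredD ?rpredZ // dhomogX /= mdeg1. Qed.

Lemma squaresP_homog k m : squaresP k m \is 2.-homog.
Proof.
have X2 i : ('X_i ^+ 2 : {mpoly C[6]}) \is 2.-homog.
  by apply: (@dhomogMn _ _ _ 1); rewrite dhomogX /= mdeg1.
by do 2!apply: rpredB => //; apply: rpred_sum => i _.
Qed.

Lemma nodeP_homog v s t : nodeP v s t \is 1.-homog.
Proof. by apply: rpredD; [apply: rpredD|]; rewrite ?dhomogZ ?dlabP_homog. Qed.

Lemma ratioP_homog p q p' q' : ratioP p q p' q' \is 4.-homog.
Proof.
by rewrite rpredB // (@dhomogM _ _ _ 2 _ 2) // (@dhomogMn _ _ _ 1) ?dlabP_homog.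
Qed.

Definition genericP : {mpoly C[6]} :=
  \prod_(p <- labels) dlabP p
  * \prod_(k <- iota 0 3) \prod_(m <- iota 0 3) squaresP k m
  * \prod_(v <- iota 0 24) \prod_(s <- [:: false; true])
      \prod_(t <- [:: false; true]) nodeP v s t
  * \prod_(p <- labels) \prod_(q <- labels | p != q) \prod_(p' <- labels)
      \prod_(q' <- labels | (p, q) != (p', q')) ratioP p q p' q'.

Lemma homog_prod (I : Type) (r : seq I) (Q : pred I) (F : I -> {mpoly C[6]}) :
  (forall i, exists d, F i \is d.-homog) ->
  exists d, \prod_(i <- r | Q i) F i \is d.-homog.
Proof.
move=> hF; elim/big_ind: _ => [|f g [d hf] [e hg]|i _]; last exact: hF.
  by exists 0%N; apply: dhomog1.
by exists (d + e)%N; apply: dhomogM.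
Qed.

Lemma genericP_homog : exists d, genericP \is d.-homog.
Proof.
have hM (f g : {mpoly C[6]}) : (exists d, f \is d.-homog) ->
    (exists d, g \is d.-homog) -> exists d, f * g \is d.-homog.
  by move=> [d hf] [e hg]; exists (d + e)%N; apply: dhomogM.
apply: (hM _ _ (hM _ _ (hM _ _ _ _) _) _).
- by apply: homog_prod => p; exists 1%N; apply: dlabP_homog.
- by do 2!apply: homog_prod => ?; exists 2%N; apply: squaresP_homog.
- by do 3!apply: homog_prod => ?; exists 1%N; apply: nodeP_homog.
- by do 4!apply: homog_prod => ?; exists 4%N; apply: ratioP_homog.
Qed.

Lemma meval_prod_neq0 (I : eqType) (r : seq I) (Q : pred I)
    (F : I -> {mpoly C[6]}) (x : 'I_6 -> C) :
  (\prod_(i <- r | Q i) F i).@[x] != 0 <->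
  (forall i, i \in r -> Q i -> (F i).@[x] != 0).
Proof.
rewrite rmorph_prod prodf_seq_neq0; split=> [/allP h i /h /implyP //|h].
by apply/allP => i ir; apply/implyP => Qi; apply: h.
Qed.

Lemma genericPE (c : 'rV[C]_6) : genericP.@[fun i => c 0 i] != 0 <-> generic c.
Proof.
rewrite /genericP 3!mevalM !mulf_eq0 !negb_or -!andbA; split.
  case/and4P => /meval_prod_neq0 h1 /meval_prod_neq0 h2 /meval_prod_neq0 h3
    /meval_prod_neq0 h4; split.
  - by move=> p pl; rewrite -dlabPE h1.
  - move=> k m k3 m3; rewrite -squaresPE.
    have /meval_prod_neq0 h : (\prod_(m <- iota 0 3) squaresP k m).@[fun i =>
      c 0 i] != 0.
      by apply: h2 => //; rewrite mem_iota.
    by apply: h => //; rewrite mem_iota.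
  - move=> v s t v24; rewrite -nodePE.
    have := h3 v; rewrite mem_iota => /(_ v24 isT)/meval_prod_neq0/(_ s).
    have inb b : b \in [:: false; true] by case: b.
    by rewrite inb => /(_ isT isT)/meval_prod_neq0/(_ t (inb t) isT).
  - move=> p q p' q' pl ql pl' ql' pq neq; rewrite -subr_eq0 -ratioPE.
    have /meval_prod_neq0/(_ q ql pq)/meval_prod_neq0 h := h4 p pl isT.
    by have /meval_prod_neq0 := h p' pl' isT; apply.
case=> h1 h2 h3 h4; apply/and4P; split.
- by apply/meval_prod_neq0 => p pl _; rewrite dlabPE h1.
- apply/meval_prod_neq0 => k; rewrite mem_iota => k3 _.
  apply/meval_prod_neq0 => m; rewrite mem_iota => m3 _.
  by rewrite squaresPE h2.
- apply/meval_prod_neq0 => v; rewrite mem_iota => v24 _.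
  by do 2!apply/meval_prod_neq0 => ? _ _; rewrite nodePE h3.
- apply/meval_prod_neq0 => p pl _; apply/meval_prod_neq0 => q ql pq.
  apply/meval_prod_neq0 => p' pl' _; apply/meval_prod_neq0 => q' ql' neq.
  by rewrite ratioPE subr_eq0 h4.
Qed.

End Generic.

(** * Nonemptiness of the generic locus: a sample hyperplane *)

Local Notation Z := BinNums.Z.

(** Gaussian integers as pairs of binary integers, so that the roughly hundred thousand inequalities
    at the sample are decided by computation. *)
Definition gmul (x y : Z * Z) : Z * Z :=
  (x.1 * y.1 - x.2 * y.2, x.1 * y.2 + x.2 * y.1).
Definition gneg (b : bool) (x : Z * Z) : Z * Z := if b then (- x.1, - x.2) else x.
Definition gadd (x y : Z * Z) : Z * Z := (x.1 + y.1, x.2 + y.2).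

Section Gaussian.
Variable C : numClosedFieldType.

Definition gauss (x : Z * Z) : C :=
  (int_of_Z x.1)%:~R + 'i * (int_of_Z x.2)%:~R.

Lemma gauss_add x y : gauss (gadd x y) = gauss x + gauss y.
Proof. by rewrite /gauss /= !rmorphD /=; ring. Qed.

Lemma gauss_neg b x : gauss (gneg b x) = (-1) ^+ b * gauss x.
Proof. by case: b; rewrite ?mul1r // /gauss /= !rmorphN /=; ring. Qed.

Lemma gauss_mul x y : gauss (gmul x y) = gauss x * gauss y.
Proof.
rewrite /gauss /= !(rmorphB, rmorphD, rmorphM) /=.
have i2 : 'i * 'i = -1 :> C by rewrite -expr2 sqrCi.
set a := _%:~R; set a' := _%:~R; set b := _%:~R; set b' := _%:~R.
transitivity (a * a' + 'i * (a * b' + b * a') + ('i * 'i) * b * b'); last by ring.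
by rewrite i2; ring.
Qed.

(** The norm x^2 + y^2 is a multiple of x + 'i y, and in characteristic zero it vanishes only at the
    origin. *)
Lemma gauss_neq0 x : (x != (0, 0)) -> gauss x != 0.
Proof.
apply: contraNneq; case: x => x y /=; rewrite /gauss /= => h.
have : ((int_of_Z x) ^+ 2 + (int_of_Z y) ^+ 2)%:~R = 0 :> C.
  rewrite rmorphD !rmorphXn /=.
  transitivity (((int_of_Z x)%:~R + 'i * (int_of_Z y)%:~R) * ((int_of_Z x)%:~R - 'i *
    (int_of_Z y)%:~R) + (('i : C) ^+ 2 + 1) * (int_of_Z y)%:~R ^+ 2).
    by ring.
  by rewrite h sqrCi addNr !mul0r addr0.
move/eqP; rewrite intr_eq0 paddr_eq0 ?sqr_ge0 // !sqrf_eq0 => /andP[/eqP hx /eqP hy].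
by rewrite -(int_of_ZK x) -(int_of_ZK y) hx hy.
Qed.

(** The values 1, ..., 6 would not do: 4 + 2'i and 6 + 3'i have a real ratio, which their conjugates
    share, against the last condition of [generic]. *)
Definition sample_coord (k : nat) : Z := nth 0 [:: 1; 2; 3; 5; 6; 7] k.
Definition sample : 'rV[C]_6 := \row_i (int_of_Z (sample_coord i))%:~R.
Definition glab (p : label) : Z * Z :=
  gadd (sample_coord (3 + p.1.2), 0) (gneg p.2 (0, sample_coord p.1.1)).

Lemma dlab_sample p : p \in labels -> dlab sample p = gauss (glab p).
Proof.
case: p => [[k m] b] /labels_lt[k3 m3].
rewrite gauss_add gauss_neg /dlab /= !mxE !inordK; last 2 first.
- exact: ltn_trans k3 _.
- by rewrite ltn_add2l.
by rewrite /gauss /= mulr0 addr0 add0r mulrA.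
Qed.

Lemma sample_generic : generic sample.
Proof.
split.
- move=> p pl; rewrite dlab_sample // gauss_neq0 //.
  have /allP : all (fun p => glab p != (0, 0)) labels by vm_compute.
  exact.
- move=> k m k3 m3; rewrite 6!big_ord_recl big_ord0 !mxE.
  have /all_iota2P/(_ k m k3 m3)/gauss_neq0 : all (fun k => all (fun m =>
   gadd (gadd (1 + (2 ^+ 2 + (3 ^+ 2 + (5 ^+ 2 + (6 ^+ 2 + 7 ^+ 2)))), 0)
       (- (sample_coord k) ^+ 2, 0))
       (- (sample_coord (3 + m)) ^+ 2, 0) != (0, 0)) (iota 0 3)) (iota 0 3).
    by vm_compute.
  rewrite !gauss_add /gauss /= !mulr0 !addr0 !rmorphN !rmorphXn /=.
  rewrite !inordK; try by case: (k) (m) k3 m3 => [|[|[|?]]] // [|[|[|?]]].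
  congr (is_true (_ != 0)); congr (_ - _ - _).
  by rewrite /sample_coord /= -!rmorphXn -!rmorphD.
- move=> v s t v24.
  rewrite !dlab_sample ?lab_in // -!gauss_neg -!gauss_add gauss_neq0 //.
  have /all_iotaP/(_ v v24) : all (fun v => all (fun s => all (fun t =>
     gadd (gadd (glab (lab v 0)) (gneg s (glab (lab v 1)))) (gneg t (glab (lab v 2)))
     != (0, 0)) [:: false; true]) [:: false; true]) (iota 0 24) by vm_compute.
  move=> /allP/(_ s); case: (s) => /(_ isT)/allP/(_ t);
    by case: (t) => /(_ isT).
- move=> p q p' q' pl ql pl' ql' pq neq.
  rewrite -subr_eq0 !dlab_sample // !expr2 -!gauss_mul -mulN1r -[-1]expr1.
  rewrite -(gauss_neg true) -gauss_add gauss_neq0 //.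
  have h : all (fun p => all (fun q => all (fun p' => all (fun q' =>
    [|| p == q, (p, q) == (p', q') |
     gadd (gmul (gmul (glab p) (glab p)) (gmul (glab q') (glab q')))
       (gneg true (gmul (gmul (glab p') (glab p')) (gmul (glab q) (glab q))))
     != (0, 0)]) labels) labels) labels) labels by vm_compute.
  move/allP/(_ p pl)/allP/(_ q ql)/allP/(_ p' pl')/allP/(_ q' ql'): h.
  by rewrite (negbTE pq) (negbTE neq).
Qed.

Lemma generic_polynomial : exists (d : nat) (P : {mpoly C[6]}),
  [/\ P != 0, P \is d.-homog &
      forall c : 'rV[C]_6, P.@[fun i => c 0 i] != 0 -> generic c].
Proof.
have [d hd] := genericP_homog C; exists d, (genericP C); split=> //; last first.
  by move=> c /genericPE.
have := proj2 (genericPE _) sample_generic; apply: contraNneq => ->.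
by rewrite meval0.
Qed.

End Gaussian.

(** * Binary forms *)

Section BinaryForms.
Variable C : numFieldType.
Implicit Types (f g x y z : C * C).

(* The pair (a, b) stands for the binary linear form a s + b t. *)
Definition ev f (s t : C) : C := s * f.1 + t * f.2.
(** Up to sign, the value of [g] at the zero [(f.2, - f.1)] of [f]. *)
Definition brk f g : C := f.1 * g.2 - f.2 * g.1.

Lemma brk_prop f g : f != (0, 0) -> brk f g = 0 ->
  exists b, forall s t, ev g s t = b * ev f s t.
Proof.
case: f g => [a b] [a' b']; rewrite xpair_eqE negb_and /brk /ev /= => nz h.
case/orP: nz => nz.
  exists (a' / a) => s t; apply: (mulfI nz).
  transitivity (a' * (s * a + t * b) + t * (a * b' - b * a')); first by ring.
  by rewrite h mulr0 addr0; field.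
exists (b' / b) => s t; apply: (mulfI nz).
transitivity (b' * (s * a + t * b) - s * (a * b' - b * a')); first by ring.
by rewrite h mulr0 subr0; field.
Qed.

Lemma ev_zero f : (forall s t, ev f s t = 0) -> f = (0, 0).
Proof.
case: f => a b h; move: (h 1 0) (h 0 1).
by rewrite /ev !(mul1r, mul0r, addr0, add0r) /= => -> ->.
Qed.

(* The two difference hypotheses hold for polynomial functions of degree at
   most 2; they recover G on the line ev f = 0 from its values off that line. *)
Lemma ev_cancel f (G : C -> C -> C) : f != (0, 0) ->
  (forall s t, G s t = 3 * G (s + 1) t - 3 * G (s + 2) t + G (s + 3) t) ->
  (forall s t, G s t = 3 * G s (t + 1) - 3 * G s (t + 2) + G s (t + 3)) ->
  (forall s t, ev f s t * G s t = 0) -> forall s t, G s t = 0.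
Proof.
move=> nz Gs Gt h s t.
have [fst0|fstN0] := eqVneq (ev f s t) 0; last first.
  by have /eqP := h s t; rewrite mulf_eq0 (negPf fstN0) => /eqP.
have vanish s' t' : ev f s' t' != 0 -> G s' t' = 0.
  by move=> n0; have /eqP := h s' t'; rewrite mulf_eq0 (negPf n0) => /eqP.
move: nz; case: f fst0 {h} vanish => [a b]; rewrite xpair_eqE negb_and /ev /=.
move=> fst0 vanish /orP[nz|nz].
  have aux n : (n%:R : C) != 0 -> G (s + n%:R) t = 0.
    move=> n0; apply: vanish; rewrite mulrDl addrAC fst0 add0r.
    by rewrite mulf_neq0.
  by rewrite Gs (aux 1) ?(aux 2) ?(aux 3) ?pnatr_eq0 // !mulr0 subrr addr0.
have aux n : (n%:R : C) != 0 -> G s (t + n%:R) = 0.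
  move=> n0; apply: vanish; rewrite mulrDl addrA fst0 add0r.
  by rewrite mulf_neq0.
by rewrite Gt (aux 1) ?(aux 2) ?(aux 3) ?pnatr_eq0 // !mulr0 subrr addr0.
Qed.

Lemma ev_mul2_eq0 f g : (forall s t, ev f s t * ev g s t = 0) ->
  f = (0, 0) \/ g = (0, 0).
Proof.
move=> h; have [->|nz] := eqVneq f (0, 0); [by left|right].
apply: ev_zero; apply: (ev_cancel nz) => // s t; rewrite /ev; ring.
Qed.

Lemma ev_mul3_eq0 f g h : (forall s t, ev f s t * ev g s t * ev h s t = 0) ->
  [\/ f = (0, 0), g = (0, 0) | h = (0, 0)].
Proof.
move=> fgh; have [->|nz] := eqVneq f (0, 0); first exact: Or31.
have gh : forall s t, ev g s t * ev h s t = 0.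
  apply: (ev_cancel nz) => s t; try by rewrite /ev; ring.
  by rewrite mulrA fgh.
by case: (ev_mul2_eq0 gh) => ->; [apply: Or32|apply: Or33].
Qed.

Lemma ev_factor2 c x1 x2 y1 y2 : c != 0 -> x1 != (0, 0) -> y1 != (0, 0) ->
  brk x1 y1 = 0 ->
  (forall s t, ev x1 s t * ev x2 s t = c * (ev y1 s t * ev y2 s t)) ->
  exists2 ab, ab.1 * ab.2 = c &
    forall s t, ev x1 s t = ab.1 * ev y1 s t /\ ev x2 s t = ab.2 * ev y2 s t.
Proof.
move=> c0 x10 y10 xy h; have [b hb] := brk_prop x10 xy.
have b0 : b != 0.
  by apply: contraNneq y10 => b0; apply/eqP/ev_zero => s t; rewrite hb b0 mul0r.
exists (b^-1, c * b); first by rewrite /= mulrCA mulVf ?mulr1.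
move=> s t; split; first by rewrite hb mulKf.
apply/eqP; rewrite -subr_eq0; apply/eqP; move: s t.
apply: (ev_cancel x10) => s t; try by rewrite /ev /=; ring.
by rewrite mulrBr h hb /=; ring.
Qed.

(** Unique factorization of binary cubics. At the zero of [x 0] some [y i] vanishes, hence is
    proportional to it; both are cancelled and the zero of [x 1] selects the next factor. Either
    order of the two remaining indices may occur, so [step1] records both. *)
Lemma ev_factor3 c (x y : nat -> C * C) : c != 0 ->
  (forall k, (k < 3)%N -> x k != (0, 0)) ->
  (forall k, (k < 3)%N -> y k != (0, 0)) ->
  (forall s t, ev (x 0%N) s t * ev (x 1%N) s t * ev (x 2%N) s t =
     c * (ev (y 0%N) s t * ev (y 1%N) s t * ev (y 2%N) s t)) ->
  exists2 sg, sg \in perm3 & exists2 a : nat -> C,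
    a 0%N * a 1%N * a 2%N = c &
    forall k s t, (k < 3)%N -> ev (x k) s t = a k * ev (y (nth 0%N sg k)) s t.
Proof.
move=> c0 x0 y0 h.
have zero0 k : ev (x k) (x k).2 (- (x k).1) = 0 by rewrite /ev; ring.
have brkE k l : ev (y l) (x k).2 (- (x k).1) = - brk (x k) (y l).
  by rewrite /ev /brk; ring.
have step1 : exists i j l, [/\ [:: i; j; l] \in perm3, [:: i; l; j] \in perm3,
    [/\ (i < 3)%N, (j < 3)%N & (l < 3)%N], brk (x 0%N) (y i) = 0 &
    forall s t, ev (y 0%N) s t * ev (y 1%N) s t * ev (y 2%N) s t
       = ev (y i) s t * (ev (y j) s t * ev (y l) s t)].
  have /eqP := h (x 0%N).2 (- (x 0%N).1); rewrite zero0 !mul0r eq_sym.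
  rewrite !mulf_eq0 (negPf c0) /= !brkE !oppr_eq0 => /orP[/orP[]|] /eqP b0.
  - by exists 0%N, 1%N, 2%N; split=> // s t; ring.
  - by exists 1%N, 0%N, 2%N; split=> // s t; ring.
  - by exists 2%N, 0%N, 1%N; split=> // s t; ring.
have [i [j [l [p1 p2 [i3 j3 l3] b0 yE]]]] := step1.
have [b hb] := brk_prop (x0 0%N isT) b0.
have bN0 : b != 0.
  apply: contraNneq (y0 i i3) => b00; apply/eqP/ev_zero => s t.
  by rewrite hb b00 mul0r.
have h2 s t : ev (x 1%N) s t * ev (x 2%N) s t
            = (c * b) * (ev (y j) s t * ev (y l) s t).
  apply/eqP; rewrite -subr_eq0; apply/eqP; move: s t.
  apply: (ev_cancel (x0 0%N isT)) => s t; try by rewrite /ev /=; ring.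
  by rewrite mulrBr [X in X - _]mulrA h yE hb; ring.
have cb0 : c * b != 0 by rewrite mulf_neq0.
have fin j' l' : [:: i; j'; l'] \in perm3 -> (j' < 3)%N -> brk (x 1%N) (y j') = 0 ->
    (forall s t, ev (x 1%N) s t * ev (x 2%N) s t
            = (c * b) * (ev (y j') s t * ev (y l') s t)) ->
    exists2 sg, sg \in perm3 & exists2 a : nat -> C,
    a 0%N * a 1%N * a 2%N = c &
    forall k s t, (k < 3)%N -> ev (x k) s t = a k * ev (y (nth 0%N sg k)) s t.
  move=> pin j'3 bj h'.
  have [ab abE hab] := ev_factor2 cb0 (x0 1%N isT) (y0 _ j'3) bj h'.
  exists [:: i; j'; l'] => //; exists (nth 0 [:: b^-1; ab.1; ab.2]) => /=.
    by rewrite -mulrA abE mulrC mulfK.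
  case=> [|[|[|//]]] s t _ /=; last 2 first.
  - exact: (proj1 (hab s t)).
  - exact: (proj2 (hab s t)).
  by rewrite hb mulKf.
have /eqP := h2 (x 1%N).2 (- (x 1%N).1); rewrite zero0 !mul0r eq_sym.
rewrite !mulf_eq0 (negPf c0) (negPf bN0) /= !brkE !oppr_eq0 => /orP[] /eqP bb.
  exact: (fin j l).
by apply: (fin l j) => // s t; rewrite h2; ring.
Qed.

(* The three coefficients of the vanishing form, paired with the coefficients
   of the form vanishing where z1 and z2 do, give a0 [z0, z1] [z0, z2] = 0. *)
Lemma diag_isotropic a0 a1 a2 z0 z1 z2 : a0 != 0 -> z0 != (0, 0) ->
  (forall s t, ev z0 s t = 0 -> ev z1 s t = 0 -> ev z2 s t = 0 -> s = 0 /\ t = 0) ->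
  (forall s t, a0 * ev z0 s t ^+ 2 + a1 * ev z1 s t ^+ 2 + a2 * ev z2 s t ^+ 2 = 0) ->
  exists s t, ev z0 s t = 0 /\
    (ev z1 s t = 0 /\ ev z2 s t != 0 /\ a2 = 0 \/
     ev z2 s t = 0 /\ ev z1 s t != 0 /\ a1 = 0).
Proof.
move=> a0N z0N ind h.
have e1 := h 1 0; have e3 := h 0 1; have e2 := h 1 1.
have : a0 * (brk z0 z1 * brk z0 z2) = 0.
  pose E s t := a0 * ev z0 s t ^+ 2 + a1 * ev z1 s t ^+ 2 + a2 * ev z2 s t ^+ 2.
  have : 2 * (a0 * (brk z0 z1 * brk z0 z2)) =
     2 * z1.2 * z2.2 * E 1 0 - (z1.1 * z2.2 + z2.1 * z1.2) * (E 1 1 - E 1 0 - E 0 1)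
     + 2 * z1.1 * z2.1 * E 0 1 by rewrite /E /ev /brk; ring.
  rewrite /E !h !(subr0, mulr0, addr0) => /eqP; rewrite mulf_eq0 pnatr_eq0 /=.
  by move/eqP.
move/eqP; rewrite !mulf_eq0 (negPf a0N) /= => bz.
exists z0.2, (- z0.1).
have z00 : ev z0 z0.2 (- z0.1) = 0 by rewrite /ev; ring.
have z0k z : ev z z0.2 (- z0.1) = - brk z0 z by rewrite /ev /brk; ring.
have nn z z' : ev z z0.2 (- z0.1) = 0 ->
    (ev z z0.2 (- z0.1) = 0 -> ev z' z0.2 (- z0.1) = 0 -> z0.2 = 0 /\ - z0.1 = 0) ->
    ev z' z0.2 (- z0.1) != 0.
  move=> hz hz'; apply: contraNneq z0N => /(hz' hz)[e e'].
  by rewrite [z0]surjective_pairing e -[z0.1]opprK e' oppr0.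
split=> //; case/orP: bz => /eqP b0; [left|right].
- have z10 : ev z1 z0.2 (- z0.1) = 0 by rewrite z0k b0 oppr0.
  have z2N : ev z2 z0.2 (- z0.1) != 0 by apply: (nn z1) => //; apply: ind.
  split=> //; split=> //; have /eqP := h z0.2 (- z0.1).
  by rewrite z00 z10 expr0n /= !mulr0 !add0r mulf_eq0 sqrf_eq0 (negPf z2N) orbF => /eqP.
- have z20 : ev z2 z0.2 (- z0.1) = 0 by rewrite z0k b0 oppr0.
  have z1N : ev z1 z0.2 (- z0.1) != 0.
    by apply: (nn z2) => // hz2 hz1; apply: ind.
  split=> //; split=> //; have /eqP := h z0.2 (- z0.1).
  by rewrite z00 z20 expr0n /= !mulr0 !add0r addr0 mulf_eq0 sqrf_eq0 (negPf z1N) orbF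
    => /eqP.
Qed.

(* An isotropic plane of the 4-space E^perp is its own orthogonal there. *)
Lemma isotropic_perp (N E : 'M[C]_(2, 6)) (c : 'rV[C]_6) :
  row_free N -> N *m N^T = 0 -> N *m E^T = 0 -> E *m E^T = 1%:M ->
  c *m N^T = 0 -> c *m E^T = 0 -> c *m c^T = 0.
Proof.
move=> freeN NN NE EE cN cE.
have EN : E *m N^T = 0 by rewrite -[E]trmxK -trmx_mul NE trmx0.
pose M := col_mx N E.
have freeM : row_free M.
  rewrite -kermx_eq0; apply/rowV0P => z /sub_kermxP.
  rewrite -[z]hsubmxK mul_row_col => h.
  have z2 : rsubmx z = 0.
    move/(congr1 (mulmxr E^T)): (h).
    by rewrite /= mulmxDl -!mulmxA NE EE mulmx0 mulmx1 add0r mul0mx.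
  move: h; rewrite z2 mul0mx addr0 => /eqP.
  by rewrite mulmx_free_eq0 // => /eqP ->; rewrite row_mx0.
have rK : \rank (kermx M^T) = 2.
  by rewrite mxrank_ker mxrank_tr (eqP freeM).
have MT : M^T = row_mx N^T E^T by rewrite tr_col_mx.
have NK : (N <= kermx M^T)%MS.
  by apply/sub_kermxP; rewrite MT mul_mx_row NN NE row_mx0.
have cK : (c <= kermx M^T)%MS.
  by apply/sub_kermxP; rewrite MT mul_mx_row cN cE row_mx0.
have KN : (kermx M^T <= N)%MS.
  by rewrite -(mxrank_leqif_sup NK) rK (eqP freeN).
have /submxP[z cE'] := submx_trans cK KN.
have Nc : N *m c^T = 0 by rewrite -[N]trmxK -trmx_mul cN trmx0.
by rewrite {1}cE' -mulmxA Nc mulmx0.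
Qed.

End BinaryForms.

(** * The lines on the surface *)

Lemma sig_perm (v : nat) : (v < 24)%N ->
  [:: sig v 0; sig v 1; sig v 2] \in perm3.
Proof.
have /all_iotaP : all (fun v => [:: sig v 0; sig v 1; sig v 2] \in perm3) (iota 0 24).
  by vm_compute.
exact.
Qed.

Lemma sig_lt (v k : nat) : (v < 24)%N -> (k < 3)%N -> (sig v k < 3)%N.
Proof.
have /all_iota2P h : all (fun v => all (fun k => sig v k < 3)%N (iota 0 3)) (iota 0 24).
  by vm_compute.
exact: h.
Qed.

Lemma line_index_ex (sg : seq nat) (b0 b1 : bool) : sg \in perm3 ->
  exists2 v, (v < 24)%N & [/\ forall k, (k < 3)%N -> sig v k = nth 0%N sg k,
    neg v 0 = b0 & neg v 1 = b1].
Proof.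
have /allP h : all (fun sg => all (fun b0 => all (fun b1 => has (fun v =>
  [&& [:: sig v 0; sig v 1; sig v 2] == sg, neg v 0 == b0 & neg v 1 == b1])
  (iota 0 24)) [:: false; true]) [:: false; true]) perm3 by vm_compute.
have inb b : b \in [:: false; true] by case: b.
move=> /h/allP/(_ b0 (inb b0))/allP/(_ b1 (inb b1))/hasP[v].
rewrite mem_iota => v24 /and3P[/eqP <- /eqP n0 /eqP n1].
by exists v => //; split=> //; case=> [|[|[|]]].
Qed.

Section Geometry.
Variable C : numClosedFieldType.
Implicit Types (P Q u w : 'cV[C]_6).

Lemma coordD P Q k : coord (P + Q) k = coord P k + coord Q k.
Proof. by rewrite /coord mxE. Qed.

Lemma coordZ (a : C) P k : coord (a *: P) k = a * coord P k.
Proof. by rewrite /coord mxE. Qed.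

Lemma coord_ext P Q : (forall k, (k < 6)%N -> coord P k = coord Q k) -> P = Q.
Proof.
by move=> h; apply/colP => i; have := h i (ltn_ord i); rewrite /coord inord_val.
Qed.

Lemma sum6 (R : nmodType) (F : 'I_6 -> R) : \sum_i F i =
  F (inord 0) + F (inord 1) + F (inord 2) + F (inord 3) + F (inord 4) + F (inord 5).
Proof.
rewrite !big_ord_recl big_ord0 addr0 !addrA.
by do !congr (_ + _); congr F; apply: val_inj; rewrite /= inordK.
Qed.

Lemma in_hyperplaneD (c : 'rV[C]_6) P Q : in_hyperplane c P -> in_hyperplane c Q ->
  in_hyperplane c (P + Q).
Proof.
move=> /eqP hP /eqP hQ; rewrite /in_hyperplane.
under eq_bigr do rewrite mxE mulrDr.
by rewrite big_split /= hP hQ addr0.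
Qed.

Lemma in_hyperplaneZ (c : 'rV[C]_6) a P : in_hyperplane c P ->
  in_hyperplane c (a *: P).
Proof.
move=> /eqP hP; rewrite /in_hyperplane.
under eq_bigr do rewrite mxE mulrCA.
by rewrite -mulr_sumr hP mulr0.
Qed.

Definition in_plane (v : nat) P : Prop := forall k, (k < 3)%N ->
  coord P k = (-1) ^+ neg v k * 'i * coord P (3 + sig v k).

Definition in_line (c : 'rV[C]_6) (v : nat) P : Prop :=
  in_plane v P /\ in_hyperplane c P.

Lemma in_lineD c v P Q : in_line c v P -> in_line c v Q -> in_line c v (P + Q).
Proof.
move=> [hP cP] [hQ cQ]; split; last exact: in_hyperplaneD.
by move=> k k3; rewrite !coordD hP // hQ // mulrDr.
Qed.

Lemma in_lineZ c v a P : in_line c v P -> in_line c v (a *: P).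
Proof.
move=> [hP cP]; split; last exact: in_hyperplaneZ.
by move=> k k3; rewrite !coordZ hP // mulrCA.
Qed.

Lemma in_hyperplane_plane (c : 'rV[C]_6) v P : (v < 24)%N -> in_plane v P ->
  \sum_i c 0 i * P i 0 = dlab c (lab v 0) * coord P (3 + sig v 0)
    + dlab c (lab v 1) * coord P (3 + sig v 1) + dlab c (lab v 2) * coord P (3 +
      sig v 2).
Proof.
move=> v24 hP; rewrite sum6 -!/(coord P _) (hP 0%N) // (hP 1%N) // (hP 2%N) //.
rewrite /dlab /=; move: (sig_perm v24); rewrite !inE.
by do ![case/orP] => /eqP[-> -> ->] /=; ring.
Qed.

Lemma plane_ext v P Q : (v < 24)%N -> in_plane v P -> in_plane v Q ->
  (forall k, (k < 3)%N -> coord P (3 + sig v k) = coord Q (3 + sig v k)) -> P = Q.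
Proof.
move=> v24 hP hQ h.
have hy m : (m < 3)%N -> coord P (3 + m) = coord Q (3 + m).
  move: (h 0%N isT) (h 1%N isT) (h 2%N isT) (sig_perm v24); rewrite !inE.
  by move=> h0 h1 h2; do ![case/orP] => /eqP[e0 e1 e2]; move: h0 h1 h2;
     rewrite e0 e1 e2; case: m => [|[|[|]]].
apply: coord_ext => k k6; case: (ltnP k 3) => k3.
  by rewrite hP // hQ // hy // sig_lt.
by have := hy (k - 3)%N; rewrite subnKC //; apply; lia.
Qed.

Lemma line_in_X c v P : (v < 24)%N -> in_line c v P -> in_humbertX c P.
Proof.
move=> v24 [hP cP]; rewrite /in_humbertX cP /=.
have i2 : 'i ^+ 2 = -1 :> C by rewrite sqrCi.
apply/andP; split; apply/eqP.
  rewrite /humbertQ sum6 -!/(coord P _) (hP 0%N) // (hP 1%N) // (hP 2%N) //.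
  rewrite !exprMn i2 !sqrr_sign; move: (sig_perm v24); rewrite !inE.
  by do ![case/orP] => /eqP[-> -> ->] /=; ring.
rewrite /humbertF (hP 0%N) // (hP 1%N) // (hP 2%N) //.
have sg : (-1) ^+ neg v 0 * (-1) ^+ neg v 1 * (-1) ^+ neg v 2 = 1 :> C.
  by rewrite /= signr_addb !mulrA -mulrA -!signr_addb; case: odd; case: odd;
    rewrite /= ?expr0 ?expr1; ring.
set y0 := coord P (3 + sig v 0); set y1 := coord P (3 + sig v 1).
set y2 := coord P (3 + sig v 2).
have -> : coord P 3 * coord P 4 * coord P 5 = y0 * y1 * y2.
  rewrite /y0 /y1 /y2; move: (sig_perm v24); rewrite !inE.
  by do ![case/orP] => /eqP[-> -> ->] /=; ring.
transitivity ('i * ('i ^+ 2 * ((-1) ^+ neg v 0 * (-1) ^+ neg v 1 * (-1) ^+ neg v 2)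
   + 1) * (y0 * y1 * y2)); first by ring.
by rewrite sg i2; ring.
Qed.

(* The span of u and w is isotropic and orthogonal to c in the four remaining
   coordinates, so that the restriction of c to these would be isotropic. *)
Lemma no_line_in_conic (c : 'rV[C]_6) u w k m : generic c ->
  (k < 3)%N -> (m < 3)%N ->
  (forall s t, s *: u + t *: w = 0 -> s = 0 /\ t = 0) ->
  (forall s t, in_humbertX c (s *: u + t *: w)) ->
  coord u k = 0 -> coord w k = 0 -> coord u (3 + m) = 0 -> coord w (3 + m) = 0 ->
  False.
Proof.
move=> [_ + _ _] k3 m3 ind hX uk wk um wm => /(_ k m k3 m3).
have k6 : (k < 6)%N by lia.
have m6 : (3 + m < 6)%N by lia.
have km : inord k != inord (3 + m) :> 'I_6.
  by rewrite -val_eqE /= !inordK //; lia.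
pose N := \matrix_(i < 2, j < 6) (if i == 0 then u j 0 else w j 0).
pose E := \matrix_(i < 2, j < 6)
  (((if i == 0 then inord k else inord (3 + m)) == j)%:R : C).
pose c' := \row_j (if (j == inord k) || (j == inord (3 + m)) then 0 else c 0 j).
have bilin : \sum_j u j 0 ^+ 2 = 0 /\ \sum_j w j 0 ^+ 2 = 0 /\
    \sum_j u j 0 * w j 0 = 0.
  have q s t : \sum_j (s *: u + t *: w) j 0 ^+ 2 = 0.
    by have /and3P[_ /eqP] := hX s t.
  have uu : \sum_j u j 0 ^+ 2 = 0.
    by rewrite -[RHS](q 1 0); apply: eq_bigr => j _; rewrite scale1r scale0r addr0.
  have ww : \sum_j w j 0 ^+ 2 = 0.
    by rewrite -[RHS](q 0 1); apply: eq_bigr => j _; rewrite scale1r scale0r add0r.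
  split=> //; split=> //; apply: (mulfI (_ : 2 != 0 :> C)); first by rewrite pnatr_eq0.
  have /eqP := q 1 1; under eq_bigr do rewrite !scale1r !mxE sqrrD.
  by rewrite !big_split /= uu ww add0r addr0 mulr0 mulr_natl mulr2n => /eqP.
have ccol P : in_hyperplane c P -> coord P k = 0 -> coord P (3 + m) = 0 ->
    \sum_j c' 0 j * P j 0 = 0.
  move=> /eqP hP Pk Pm; rewrite -[RHS]hP; apply: eq_bigr => j _; rewrite mxE.
  by case: eqVneq => [->|_] /=; rewrite -?/(coord P _) ?Pk ?mulr0 //;
     case: eqVneq => [->|_] //=; rewrite -?/(coord P _) ?Pm ?mulr0.
have cu : \sum_j c' 0 j * u j 0 = 0.
  by apply: ccol => //; have := hX 1 0; rewrite scale1r scale0r addr0 => /and3P[].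
have cw : \sum_j c' 0 j * w j 0 = 0.
  by apply: ccol => //; have := hX 0 1; rewrite scale1r scale0r add0r => /and3P[].
have sumE P i : \sum_j P j 0 * E i j = coord P (if i == 0 then k else (3 + m)%N).
  rewrite (bigD1 (if i == 0 then inord k else inord (3 + m))) //= big1.
    by rewrite mxE eqxx mulr1 addr0 /coord; case: (i == 0).
  by move=> j; rewrite eq_sym mxE => /negPf->; rewrite mulr0.
have [uu [ww uw]] := bilin.
have c'c : c' *m c'^T = 0.
  apply: (@isotropic_perp _ N E) => //.
  - rewrite -kermx_eq0; apply/rowV0P => z /sub_kermxP zN.
    have [] : z 0 0 = 0 /\ z 0 1 = 0.
      apply: ind; apply/colP => j; have /rowP/(_ j) := zN.
      rewrite !mxE !big_ord_recl big_ord0 !mxE /= addr0.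
      by have -> : lift ord0 ord0 = 1 :> 'I_2 by apply: val_inj.
    move=> z0 z1; apply/rowP => i; rewrite mxE.
    have [->|i0] := eqVneq i 0; first exact: z0.
    by have -> : i = 1 by apply: val_inj; case: i i0 => [[|[|//]]].
  - apply/matrixP => i l; rewrite !mxE.
    case: (eqVneq i 0) => i0; case: (eqVneq l 0) => l0.
    + rewrite -[RHS]uu; apply: eq_bigr => j _; rewrite !mxE i0 l0 /=; ring.
    + rewrite -[RHS]uw; apply: eq_bigr => j _; rewrite !mxE i0 (negPf l0) /=; ring.
    + rewrite -[RHS]uw; apply: eq_bigr => j _; rewrite !mxE (negPf i0) l0 /=; ring.
    + rewrite -[RHS]ww; apply: eq_bigr => j _; rewrite !mxE (negPf i0) (negPf l0) /=;
      ring.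
  - apply/matrixP => i l; rewrite !mxE.
    transitivity (\sum_j (if i == 0 then u else w) j 0 * E l j).
      by apply: eq_bigr => j _; rewrite !mxE; case: (i == 0).
    by rewrite sumE; case: (i == 0); case: (l == 0).
  - apply/matrixP => i l; rewrite !mxE.
    transitivity (\sum_j (row i E)^T j 0 * E l j).
      by apply: eq_bigr => j _; rewrite !mxE.
    rewrite sumE /coord !mxE; case: i l => [[|[|//]] i2] [[|[|//]] l2] /=.
    + by rewrite eqxx.
    + by rewrite (negPf km).
    + by rewrite eq_sym (negPf km).
    + by rewrite eqxx.
  - apply/matrixP => i l; rewrite !mxE.
    case: (eqVneq l 0) => l0.
      by rewrite -[RHS]cu; apply: eq_bigr => j _; rewrite !mxE l0.
    by rewrite -[RHS]cw; apply: eq_bigr => j _; rewrite !mxE (negPf l0).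
  - apply/matrixP => i l; rewrite !mxE.
    transitivity (\sum_j c'^T j 0 * E l j).
      by apply: eq_bigr => j _; rewrite !mxE.
    rewrite sumE /coord !mxE; case: (l == 0); first by rewrite eqxx.
    by rewrite eqxx orbT.
(* The norm of [c'] vanishes exactly when R_c is tangent to the quadric surface x_k = y_m = 0, and
   it is the quantity that [generic] keeps nonzero. *)
move/eqP; apply; move/matrixP/(_ 0 0): c'c; rewrite !mxE => c'c.
move: c'c; rewrite (bigD1 (inord k)) //= (bigD1 (inord (3 + m))) 1?eq_sym //=.
rewrite !mxE !eqxx orbT /= !mul0r !add0r => c'c.
rewrite (bigD1 (inord k)) //= (bigD1 (inord (3 + m))) 1?eq_sym //= -[RHS]c'c.
set R := (X in _ + (_ + X)); transitivity R; first by ring.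
by apply: eq_bigr => j /andP[/negPf jk /negPf jm]; rewrite !mxE jk jm.
Qed.

End Geometry.

Lemma perm3P (sg : seq nat) : sg \in perm3 ->
  [/\ (nth 0 sg 0 < 3), (nth 0 sg 1 < 3) & (nth 0 sg 2 < 3)]%N.
Proof. by rewrite !inE; do ![case/orP] => /eqP->. Qed.

Lemma label_in_labels (k m : nat) b : (k < 3)%N -> (m < 3)%N -> (k, m, b) \in labels.
Proof.
have /all_iota2P h : all (fun k => all (fun m => ((k, m, false) \in labels) &&
  ((k, m, true) \in labels)) (iota 0 3)) (iota 0 3) by vm_compute.
by move=> k3 m3; have /andP[] := h _ _ k3 m3; case: b.
Qed.

Section Lines.
Variable C : numClosedFieldType.
Implicit Types (P Q u w : 'cV[C]_6).

Lemma sum3 (F : nat -> C) : \sum_(i < 3) F i = F 0%N + F 1%N + F 2%N.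
Proof. by rewrite !big_ord_recl big_ord0 addr0 addrA. Qed.

Lemma sqr_m1P (a : C) : 1 + a ^+ 2 = 0 -> exists b : bool, a = (-1) ^+ b * 'i.
Proof.
move=> h; have : (a - 'i) * (a + 'i) = 0.
  by rewrite -subr_sqr sqrCi opprK addrC.
move/eqP; rewrite mulf_eq0 subr_eq0 addr_eq0 => /orP[] /eqP ->.
  by exists false; rewrite mul1r.
by exists true; rewrite mulN1r.
Qed.

(* Along a line of X the identity x_0 x_1 x_2 = - 'i y_0 y_1 y_2 between
   binary forms matches each x_k with a multiple of some y_(sigma k), by unique
   factorization. *)
Lemma lines_classification (c : 'rV[C]_6) u w : generic c ->
  (forall s t, s *: u + t *: w = 0 -> s = 0 /\ t = 0) ->
  (forall s t, in_humbertX c (s *: u + t *: w)) ->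
  exists2 v, (v < 24)%N & in_line c v u /\ in_line c v w.
Proof.
move=> gen ind hX.
pose fm k : C * C := (coord u k, coord w k).
have evE k s t : ev (fm k) s t = coord (s *: u + t *: w) k.
  by rewrite /ev coordD !coordZ.
have cubic s t : ev (fm 0%N) s t * ev (fm 1%N) s t * ev (fm 2%N) s t =
    - 'i * (ev (fm 3%N) s t * ev (fm 4%N) s t * ev (fm 5%N) s t).
  rewrite !evE; have /and3P[_ _ /eqP] := hX s t.
  by rewrite /humbertF => /eqP; rewrite addr_eq0 => /eqP ->; ring.
have iN0 : - 'i != 0 :> C by rewrite oppr_eq0 neq0Ci.
have xy0 k m : (k < 3)%N -> (m < 3)%N -> fm k = (0, 0) -> fm (3 + m)%N = (0, 0) ->
  False.
  by move=> k3 m3 [uk wk] [um wm]; apply: (no_line_in_conic gen k3 m3 ind hX).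
have ev0 s t : ev (0, 0) s t = 0 :> C by rewrite /ev !mulr0 addr0.
(* If x_k vanished along the line, the cubic identity would make some y_m vanish too, and the line
   would lie in a smooth conic. The same holds with x and y exchanged. *)
have x0 k : (k < 3)%N -> fm k != (0, 0).
  move=> k3; apply/eqP => fk.
  have : [\/ fm 3%N = (0, 0), fm 4%N = (0, 0) | fm 5%N = (0, 0)].
    apply: ev_mul3_eq0 => s t; apply: (mulfI iN0); rewrite mulr0 -cubic.
    by case: k k3 fk => [|[|[|//]]] _ ->; rewrite ev0 ?mulr0 ?mul0r.
  by case; [apply: (xy0 k 0%N)|apply: (xy0 k 1%N)|apply: (xy0 k 2%N)].
have y0 m : (m < 3)%N -> fm (3 + m)%N != (0, 0).
  move=> m3; apply/eqP => fk.
  have : [\/ fm 0%N = (0, 0), fm 1%N = (0, 0) | fm 2%N = (0, 0)].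
    apply: ev_mul3_eq0 => s t; rewrite cubic.
    by case: m m3 fk => [|[|[|//]]] _ ->; rewrite ev0 ?(mulr0, mul0r).
  by case=> h; [apply: (xy0 0%N m) h fk|apply: (xy0 1%N m) h fk|apply:
    (xy0 2%N m) h fk].
have [sg sgP [a aE ha]] := ev_factor3 iN0 x0 (y := fun m => fm (3 + m)%N) y0 cubic.
have [s0 s1 s2] := perm3P sgP.
pose z k := fm (3 + nth 0%N sg k)%N.
have sg3 k : (k < 3)%N -> (nth 0%N sg k < 3)%N by case: k => [|[|[|//]]].
have zE k s t : ev (z k) s t = coord (s *: u + t *: w) (3 + nth 0%N sg k) by exact: evE.
have zsum (F : nat -> C) : F 0%N + F 1%N + F 2%N =
    F (nth 0%N sg 0) + F (nth 0%N sg 1) + F (nth 0%N sg 2).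
  by move: sgP; rewrite !inE; do ![case/orP] => /eqP-> /=; ring.
have xE k s t : (k < 3)%N -> coord (s *: u + t *: w) k = a k * ev (z k) s t.
  by move=> k3; rewrite -evE ha.
(* With x_k = a_k y_(sigma k) the quadric becomes diagonal in the z_k; it remains to show that all
   its coefficients 1 + a_k^2 vanish. *)
have quad s t : \sum_(i < 3) (1 + a i ^+ 2) * ev (z i) s t ^+ 2 = 0.
  have /and3P[_ /eqP + _] := hX s t; set P := s *: u + t *: w.
  pose F m := coord P (3 + m) ^+ 2.
  have -> : humbertQ P = coord P 0 ^+ 2 + coord P 1 ^+ 2 + coord P 2 ^+ 2
      + (F 0%N + F 1%N + F 2%N) by rewrite /humbertQ sum6 !addrA.
  rewrite zsum /F -!zE !xE // => P0.
  by rewrite (sum3 (fun i => (1 + a i ^+ 2) * ev (z i) s t ^+ 2)) -[RHS]P0; ring.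
have hyp s t : \sum_(i < 3) (c 0 (inord (3 + nth 0%N sg i)) +
  a i * c 0 (inord i)) * ev (z i) s t = 0.
  have /and3P[/eqP + _ _] := hX s t; set P := s *: u + t *: w.
  pose F m := c 0 (inord (3 + m)) * coord P (3 + m).
  have -> : \sum_i c 0 i * P i 0 = c 0 (inord 0) * coord P 0 + c 0 (inord 1) * coord P 1
      + c 0 (inord 2) * coord P 2 + (F 0%N + F 1%N + F 2%N) by rewrite sum6 !addrA.
  rewrite zsum /F -!zE !xE // => P0.
  by rewrite (sum3 (fun i =>
    (c 0 (inord (3 + nth 0%N sg i)) + a i * c 0 (inord i)) * ev (z i) s t)) -[RHS]P0;
      ring.
have zind s t : (forall k, (k < 3)%N -> ev (z k) s t = 0) -> s = 0 /\ t = 0.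
  move=> z0; apply: ind; apply: coord_ext => k k6; rewrite [RHS]/coord mxE.
  case: (ltnP k 3) => k3; first by rewrite xE // z0 // mulr0.
  have [m m3 <-] : exists2 m, (m < 3)%N & (3 + nth 0%N sg m = k)%N.
    have : (k - 3 < 3)%N by lia.
    rewrite -(subnKC k3); move: (k - 3)%N sgP => m; rewrite addKn !inE.
    by do ![case/orP] => /eqP->; case: m => [|[|[|//]]] _;
      first [by exists 0%N | by exists 1%N | by exists 2%N].
  by rewrite -zE z0.
have zN0 k : (k < 3)%N -> z k != (0, 0) by move=> k3; apply/y0/sg3.
have notnode j s t : (j < 3)%N -> 1 + a j ^+ 2 = 0 -> ev (z j) s t != 0 ->
    (forall k, (k < 3)%N -> k != j -> ev (z k) s t = 0) -> False.
  move=> j3 /sqr_m1P[b ab] zj zk; have [gen1 _ _ _] := gen.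
  have := gen1 (j, nth 0%N sg j, b) (label_in_labels b j3 (sg3 j j3)).
  move/eqP; apply; apply: (mulIf zj); rewrite mul0r -(hyp s t).
  rewrite (bigD1 (Ordinal j3)) //= big1 ?addr0 /dlab /= ?ab //.
  by move=> i ij; rewrite zk ?mulr0.
(* A nonzero coefficient would produce, by [diag_isotropic], a point of the line with a single
   nonzero z_j and 1 + a_j^2 = 0. That is a node, and R_c avoids it. *)
have a2 k : (k < 3)%N -> 1 + a k ^+ 2 = 0.
  have q s t : (1 + a 0%N ^+ 2) * ev (z 0%N) s t ^+ 2 + (1 + a 1%N ^+
    2) * ev (z 1%N) s t ^+ 2
     + (1 + a 2%N ^+ 2) * ev (z 2%N) s t ^+ 2 = 0.
    by rewrite -(quad s t) (sum3 (fun i => (1 + a i ^+ 2) * ev (z i) s t ^+ 2)).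
  have zi s t : ev (z 0%N) s t = 0 -> ev (z 1%N) s t = 0 -> ev (z 2%N) s t = 0 ->
      s = 0 /\ t = 0.
    by move=> z0 z1 z2; apply: zind; case=> [|[|[|]]].
  case: k => [|[|[|//]]] _; apply/eqP/negPn/negP => aN.
  - have [s [t [h0 [[h1 [h2 h3]]|[h1 [h2 h3]]]]]] :=
    diag_isotropic aN (zN0 0%N isT) zi q.
      by apply: (notnode 2%N s t) => //; case=> [|[|[|]]].
    by apply: (notnode 1%N s t) => //; case=> [|[|[|]]].
  - have [||s [t [h0 [[h1 [h2 h3]]|[h1 [h2 h3]]]]]] := @diag_isotropic _ _
      (1 + a 0%N ^+ 2) (1 + a 2%N ^+ 2) _ (z 0%N) (z 2%N) aN (zN0 1%N isT).
    + by move=> s t z1 z0 z2; apply: zi.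
    + by move=> s t; rewrite -(q s t); ring.
    + by apply: (notnode 2%N s t) => //; case=> [|[|[|]]].
    + by apply: (notnode 0%N s t) => //; case=> [|[|[|]]].
  - have [||s [t [h0 [[h1 [h2 h3]]|[h1 [h2 h3]]]]]] := @diag_isotropic _ _
      (1 + a 0%N ^+ 2) (1 + a 1%N ^+ 2) _ (z 0%N) (z 1%N) aN (zN0 2%N isT).
    + by move=> s t z1 z0 z2; apply: zi.
    + by move=> s t; rewrite -(q s t); ring.
    + by apply: (notnode 1%N s t) => //; case=> [|[|[|]]].
    + by apply: (notnode 0%N s t) => //; case=> [|[|[|]]].
have [b0 ab0] := sqr_m1P (a2 0%N isT).
have [b1 ab1] := sqr_m1P (a2 1%N isT).
have [b2 ab2] := sqr_m1P (a2 2%N isT).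
(* The product of the a_k is - 'i = 'i^3, so the three signs multiply to 1. *)
have b2E : b2 = b0 (+) b1.
  have i3 : 'i * 'i * 'i = - 'i :> C by rewrite -expr2 sqrCi mulN1r.
  have : (-1) ^+ (b0 (+) b1 (+) b2) * - 'i = 1 * - 'i :> C.
    rewrite mul1r -[RHS]aE ab0 ab1 ab2 -i3 !signr_addb; ring.
  move/(mulIf iN0); case: (b0) (b1) (b2) => [] [] [] //= /eqP;
    by rewrite expr1 eq_sym -subr_eq0 opprK -(natrD _ 1 1) pnatr_eq0.
have [v v24 [vs vn0 vn1]] := line_index_ex b0 b1 sgP.
have aN k : (k < 3)%N -> a k = (-1) ^+ neg v k * 'i.
  case: k => [|[|[|//]]] _; rewrite ?vn0 ?vn1 //.
  by rewrite ab2 b2E -vn0 -vn1.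
have pl s t : in_plane v (s *: u + t *: w).
  by move=> k k3; rewrite xE // zE vs // aN.
exists v => //; split; split.
- by move: (pl 1 0); rewrite scale1r scale0r addr0.
- by have := hX 1 0; rewrite scale1r scale0r addr0 => /and3P[].
- by move: (pl 0 1); rewrite scale1r scale0r add0r.
- by have := hX 0 1; rewrite scale1r scale0r add0r => /and3P[].
Qed.

End Lines.

(** * Incidence of the lines *)

(** With [nxx], the two other places in cyclic order, so that the three forms z_(nx k)^2 - z_(nxx
    k)^2 sum to zero. *)
Definition nx (k : nat) : nat := nth 0%N [:: 1; 2; 0]%N k.
Definition nxx (k : nat) : nat := nth 0%N [:: 2; 0; 1]%N k.

(** The permutations differ by the transposition fixing [k]. The signs agree at [k] and have product
    1 on both lines, so they differ at both other places or at neither. *)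
Lemma adjk_swap (k v u : nat) : (k < 3)%N -> (v < 24)%N -> (u < 24)%N -> adjk k v u ->
  [/\ sig u (nx k) = sig v (nxx k), sig u (nxx k) = sig v (nx k),
      lab v k = lab u k &
      neg v (nxx k) (+) neg u (nxx k) = neg v (nx k) (+) neg u (nx k)].
Proof.
have /all_iota3P h : all (fun k => all (fun v => all (fun u => if adjk k v u then
  [&& sig u (nx k) == sig v (nxx k), sig u (nxx k) == sig v (nx k),
      lab v k == lab u k &
      neg v (nxx k) (+) neg u (nxx k) == neg v (nx k) (+) neg u (nx k)] else true)
  (iota 0 24)) (iota 0 24)) (iota 0 3) by vm_compute.
move=> k3 v24 u24 vu; have := h _ _ _ k3 v24 u24.
by rewrite vu => /and4P[/eqP-> /eqP-> /eqP-> /eqP->].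
Qed.

Lemma adjk_sign_ex (k v : nat) (s : bool) : (k < 3)%N -> (v < 24)%N ->
  exists u : 'I_24, adjk k v u /\ neg v (nx k) (+) neg u (nx k) = s.
Proof.
have /all_iota2P h : all (fun k => all (fun v => all (fun s => has (fun u =>
  adjk k v u && (neg v (nx k) (+) neg u (nx k) == s)) (iota 0 24))
  [:: false; true]) (iota 0 24)) (iota 0 3) by vm_compute.
move=> k3 v24; have /allP/(_ s) := h _ _ k3 v24.
have -> : s \in [:: false; true] by case: (s).
move=> /(_ isT)/hasP[u]; rewrite mem_iota => u24 /andP[vu /eqP e].
by exists (Ordinal u24).
Qed.

Lemma adj_irr v : adj v v = false.
Proof. by rewrite /adj /= /adjk !eqxx. Qed.

Lemma lab_ex (k m : nat) (b : bool) : (k < 3)%N -> (m < 3)%N ->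
  exists v : 'I_24, lab v k = (k, m, b).
Proof.
have /all_iota2P h : all (fun k => all (fun m => all (fun b => has (fun v =>
  lab v k == (k, m, b)) (iota 0 24)) [:: false; true]) (iota 0 3)) (iota 0 3).
  by vm_compute.
move=> k3 m3; have /allP/(_ b) := h _ _ k3 m3.
have -> : b \in [:: false; true] by case: (b).
move=> /(_ isT)/hasP[v]; rewrite mem_iota => v24 /eqP e.
by exists (Ordinal v24).
Qed.

(** The cases are those of the relative permutation: the identity, where the sign product leaves
    exactly two opposite signs; a transposition, where non-adjacency means opposite signs at its
    fixed place; the two 3-cycles. *)
Lemma non_adj_cases (v u : nat) : (v < 24)%N -> (u < 24)%N -> v != u -> ~~ adj v u ->
  [\/ exists2 j, (j < 3)%N & forall k, (k < 3)%N -> k != j ->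
        sig u k = sig v k /\ neg u k = ~~ neg v k,
      exists2 k, (k < 3)%N & [/\ sig u k = sig v k, neg u k = ~~ neg v k,
        sig u (nx k) = sig v (nxx k), sig u (nxx k) = sig v (nx k) &
        neg v (nxx k) (+) neg u (nxx k) = ~~ (neg v (nx k) (+) neg u (nx k))],
      forall k, (k < 3)%N -> sig u k = sig v (nx k) |
      forall k, (k < 3)%N -> sig u k = sig v (nxx k)].
Proof.
have /all_iota2P h : all (fun v => all (fun u => (v == u) || adj v u ||
   [|| has (fun j => all (fun k => (k == j) ||
          (sig u k == sig v k) && (neg u k == ~~ neg v k)) (iota 0 3)) (iota 0 3),
       has (fun k => [&& sig u k == sig v k, neg u k == ~~ neg v k,
        sig u (nx k) == sig v (nxx k), sig u (nxx k) == sig v (nx k) &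
        neg v (nxx k) (+) neg u (nxx k) == ~~ (neg v (nx k) (+) neg u (nx k))])
        (iota 0 3),
       all (fun k => sig u k == sig v (nx k)) (iota 0 3) |
       all (fun k => sig u k == sig v (nxx k)) (iota 0 3)])
   (iota 0 24)) (iota 0 24) by vm_compute.
move=> v24 u24 vu nadj; have := h _ _ v24 u24.
rewrite (negPf vu) (negPf nadj) 2!orFb.
case/or4P => [/hasP[j]|/hasP[k]|/all_iotaP e|/all_iotaP e].
- rewrite mem_iota => j3 /all_iotaP e; apply: Or41; exists j => // k k3 kj.
  by have := e k k3; rewrite (negPf kj) => /andP[/eqP-> /eqP->].
- rewrite mem_iota => k3 /and5P[/eqP ? /eqP ? /eqP ? /eqP ? /eqP ?].
  by apply: Or42; exists k.
- by apply: Or43 => k /e /eqP.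
- by apply: Or44 => k /e /eqP.
Qed.

Section Incidence.
Variables (C : numClosedFieldType) (c : 'rV[C]_6).
Hypothesis gen : generic c.
Implicit Types (P Q : 'cV[C]_6).

Definition zc (v k : nat) P : C := coord P (3 + sig v k).
Local Notation d v k := (dlab c (lab v k)).
Local Notation L := (in_line c).

Lemma zcD v k P Q : zc v k (P + Q) = zc v k P + zc v k Q.
Proof. exact: coordD. Qed.

Lemma zcZ v k (a : C) P : zc v k (a *: P) = a * zc v k P.
Proof. exact: coordZ. Qed.

Lemma d_neq0 v k : (v < 24)%N -> (k < 3)%N -> d v k != 0.
Proof. by have [h _ _ _] := gen => v24 k3; apply/h/lab_in. Qed.

Lemma line_eq v P : (v < 24)%N -> L v P ->
  d v 0 * zc v 0 P + d v 1 * zc v 1 P + d v 2 * zc v 2 P = 0.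
Proof. by move=> v24 [hP /eqP]; rewrite (in_hyperplane_plane c v24 hP). Qed.

Lemma line_eqk v k P : (v < 24)%N -> (k < 3)%N -> L v P ->
  d v k * zc v k P + d v (nx k) * zc v (nx k) P + d v (nxx k) * zc v (nxx k) P = 0.
Proof.
move=> v24 k3 /(line_eq v24) <-.
by case: k k3 => [|[|[|//]]] _; rewrite /nx /nxx /=; ring.
Qed.

Lemma line_pt v (z : nat -> C) : (v < 24)%N ->
  d v 0 * z 0%N + d v 1 * z 1%N + d v 2 * z 2%N = 0 ->
  exists2 P, L v P & forall k, (k < 3)%N -> zc v k P = z k.
Proof.
move=> v24 dz.
pose y m := z (index m [:: sig v 0; sig v 1; sig v 2]).
have yE k : (k < 3)%N -> y (sig v k) = z k.
  rewrite /y; move: (sig_perm v24); rewrite !inE.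
  case: k => [|[|[|//]]] + _;
    by do ![case/orP] => /eqP[e0 e1 e2]; rewrite ?e0 ?e1 ?e2 /=.
pose P : 'cV[C]_6 := \col_i (if (i < 3)%N
  then (-1) ^+ neg v i * 'i * y (sig v i) else y (i - 3)%N).
have zP k : (k < 3)%N -> zc v k P = z k.
  move=> k3; have s3 := sig_lt v24 k3.
  rewrite /zc /coord mxE inordK; last by rewrite (ltn_add2l 3 _ 3).
  by rewrite ltnNge leq_addr addKn /= yE.
have plP : in_plane v P.
  move=> k k3; have k6 : (k < 6)%N by lia.
  by rewrite -/(zc v k P) zP // /coord mxE inordK // k3 yE.
exists P => //; split=> //.
by rewrite /in_hyperplane (in_hyperplane_plane c v24 plP) -!/(zc v _ P) !zP // dz.
Qed.

Lemma line_pt0 v P : (v < 24)%N -> L v P ->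
  (forall k, (k < 3)%N -> zc v k P = 0) -> P = 0.
Proof.
move=> v24 [hP _] h; have z0 j : coord 0 j = 0 :> C by rewrite /coord mxE.
apply: (plane_ext v24 hP) => [k k3|k /h]; rewrite ?z0 ?mulr0 //.
Qed.

Lemma line_pt0k v k P : (v < 24)%N -> (k < 3)%N -> L v P ->
  zc v (nx k) P = 0 -> zc v (nxx k) P = 0 -> P = 0.
Proof.
move=> v24 k3 hP h1 h2; apply: (line_pt0 v24 hP).
have /eqP := line_eqk v24 k3 hP.
rewrite h1 h2 !mulr0 !addr0 mulf_eq0 (negPf (d_neq0 v24 k3)) => /eqP h0.
by move: h0 h1 h2; case: k k3 => [|[|[|//]]] _ h0 h1 h2; case=> [|[|[|]]].
Qed.

(** Such a point has coordinates z_k equal up to sign: if nonzero it is one of the 16 nodes excluded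
    by the third condition of [generic]. *)
Lemma line_sqr_eq0 v P : (v < 24)%N -> L v P -> zc v 0 P ^+ 2 = zc v 1 P ^+ 2 ->
  zc v 1 P ^+ 2 = zc v 2 P ^+ 2 -> P = 0.
Proof.
move=> v24 hP e01 e12.
have sgn (a b : C) : a ^+ 2 = b ^+ 2 -> exists s : bool, a = (-1) ^+ s * b.
  move/eqP; rewrite eqf_sqr => /orP[]/eqP->; first by exists false; rewrite mul1r.
  by exists true; rewrite mulN1r.
have [s hs] := sgn _ _ (esym e01); have [t ht] := sgn _ _ (esym (etrans e01 e12)).
have [_ _ /(_ v s t v24) gen3 _] := gen.
have /eqP := line_eq v24 hP; rewrite hs ht.
have -> : d v 0 * zc v 0 P + d v 1 * ((-1) ^+ s * zc v 0 P) + d v 2 * ((-1) ^+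
  t * zc v 0 P)
  = (d v 0 + (-1) ^+ s * d v 1 + (-1) ^+ t * d v 2) * zc v 0 P by ring.
rewrite mulf_eq0 (negPf gen3) => /eqP z0.
by apply: (@line_pt0k v 2 _ v24 isT hP); rewrite /nx /nxx /= ?hs z0 ?mulr0.
Qed.

Lemma plane_signs v u k P : (k < 3)%N -> in_plane v P -> in_plane u P ->
  zc v k P = (-1) ^+ (neg v k (+) neg u k) * zc u k P.
Proof.
move=> k3 hv hu; have := hv k k3; rewrite (hu k k3) -/(zc v k P) -/(zc u k P) => e.
have i0 : 'i != 0 :> C by exact: neq0Ci.
apply: (mulfI i0); apply: (mulfI (_ : (-1) ^+ neg v k != 0 :> C)).
  by rewrite signr_eq0.
rewrite mulrA -e signr_addb.
transitivity (((-1) ^+ neg v k * (-1) ^+ neg v k) * ((-1) ^+ neg u k * 'i * zc u k P)).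
  by rewrite -signr_addb addbb mul1r.
by ring.
Qed.

(** The equation at [k] is shared; the other two are exchanged by the transposition and, on [L v],
    become the same relation z_(nx k) = +- z_(nxx k). *)
Lemma adjk_line k v u P : (k < 3)%N -> (v < 24)%N -> (u < 24)%N -> adjk k v u ->
  L v P -> (L u P <->
    zc v (nx k) P = (-1) ^+ (neg v (nx k) (+) neg u (nx k)) * zc v (nxx k) P).
Proof.
move=> k3 v24 u24 vu [hv hP].
have [e1 e2 [e3 e4] e5] := adjk_swap k3 v24 u24 vu.
have x3 : (nx k < 3)%N /\ (nxx k < 3)%N by case: k k3 {vu e1 e2 e3 e4 e5} => [|[|[|]]].
split=> [[hu _]|h]; first by rewrite (plane_signs x3.1 hv hu) [zc u _ _]/zc e1.
split=> //.
have aux j : (j < 3)%N -> zc v j P = (-1) ^+ (neg v j (+) neg u j) * zc u j P ->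
    coord P j = (-1) ^+ neg u j * 'i * zc u j P.
  move=> j3 e; rewrite (hv j j3) -/(zc v j P) e signr_addb.
  transitivity (((-1) ^+ neg v j * (-1) ^+ neg v j) * ((-1) ^+
    neg u j * 'i * zc u j P)).
    by ring.
  by rewrite -signr_addb addbb mul1r.
have hk : zc v k P = (-1) ^+ (neg v k (+) neg u k) * zc u k P.
  by rewrite e4 addbb mul1r /zc e3.
have h1 : zc v (nx k) P = (-1) ^+ (neg v (nx k) (+) neg u (nx k)) * zc u (nx k) P.
  by rewrite h [zc u _ _]/zc e1.
have h2 : zc v (nxx k) P = (-1) ^+ (neg v (nxx k) (+) neg u (nxx k)) * zc u (nxx k) P.
  by rewrite e5 [zc u _ _]/zc e2 -/(zc v (nx k) P) h mulrA -signr_addb addbb mul1r.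
move: (aux _ k3 hk) (aux _ x3.1 h1) (aux _ x3.2 h2) => a0 a1 a2 j j3.
rewrite -/(zc u j P).
by move: a0 a1 a2; case: k k3 {vu e1 e2 e3 e4 e5 x3 h hk h1 h2} =>
  [|[|[|//]]] _ a0 a1 a2;
  case: j j3 => [|[|[|//]]].
Qed.

(** The two signs in z_(nx k) = +- z_(nxx k) belong to the two neighbours of kind [k]. *)
Lemma sqr_zc_line k v P : (k < 3)%N -> (v < 24)%N -> L v P ->
  (zc v (nx k) P ^+ 2 = zc v (nxx k) P ^+ 2 <->
   exists u : 'I_24, adjk k v u /\ L u P).
Proof.
move=> k3 v24 hP; split.
  move/eqP; rewrite eqf_sqr => h.
  have [s hs] : exists s : bool, zc v (nx k) P = (-1) ^+ s * zc v (nxx k) P.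
    case/orP: h => /eqP->; first by exists false; rewrite mul1r.
    by exists true; rewrite mulN1r.
  have [u [vu us]] := adjk_sign_ex s k3 v24; exists u; split=> //.
  by apply/(adjk_line k3 v24 (ltn_ord u) vu hP); rewrite us.
case=> u [vu /(adjk_line k3 v24 (ltn_ord u) vu hP) ->].
by rewrite exprMn sqrr_sign mul1r.
Qed.

Lemma adjk_meet k v u : (k < 3)%N -> (v < 24)%N -> (u < 24)%N -> adjk k v u ->
  exists P, [/\ P != 0, L v P & L u P].
Proof.
move=> k3 v24 u24 vu; pose s : C := (-1) ^+ (neg v (nx k) (+) neg u (nx k)).
(* The solution of the line equation with z_(nx k) = s z_(nxx k), scaled by [d v k] to avoid a
   division. *)
pose z j : C := if j == nx k then s * d v k else if j == nxx k then d v k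
  else - (s * d v (nx k) + d v (nxx k)).
have [|P hP zP] := @line_pt v z v24.
  by rewrite /z; case: k k3 @s @z {vu} => [|[|[|//]]] _ s z; rewrite /nx /nxx /=; ring.
have [n3 nn3 nnn] : [/\ nx k < 3, nxx k < 3 & (nxx k == nx k) = false]%N.
  by case: (k) k3 => [|[|[|]]].
have zx : zc v (nx k) P = s * d v k by rewrite zP // /z eqxx.
have zxx : zc v (nxx k) P = d v k by rewrite zP // /z nnn eqxx.
exists P; split=> //; last by apply/(adjk_line k3 v24 u24 vu hP); rewrite zx zxx.
apply: contraTneq (d_neq0 v24 k3) => P0; rewrite -zxx P0.
by rewrite /zc /coord mxE eqxx.
Qed.

Lemma adjk_meet_uniq k v u P Q : (k < 3)%N -> (v < 24)%N -> (u < 24)%N -> adjk k v u ->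
  P != 0 -> L v P -> L u P -> L v Q -> L u Q -> exists a, Q = a *: P.
Proof.
move=> k3 v24 u24 vu P0 vP uP vQ uQ.
have z0 R : L v R -> L u R -> zc v (nxx k) R = 0 -> R = 0.
  move=> vR uR h; apply: (line_pt0k v24 k3 vR) => //.
  by have /(adjk_line k3 v24 u24 vu vR) -> := uR; rewrite h mulr0.
have zP : zc v (nxx k) P != 0 by apply: contraNneq P0 => /(z0 _ vP uP)->.
exists (zc v (nxx k) Q / zc v (nxx k) P); apply/eqP; rewrite -subr_eq0 -scaleNr.
apply/eqP/z0.
- by apply: in_lineD => //; apply: in_lineZ.
- by apply: in_lineD => //; apply: in_lineZ.
- by rewrite zcD zcZ mulNr divfK // subrr.
Qed.

(** Opposite signs kill two of the z_k; a transposition gives z = - z at an exchanged place; a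
    3-cycle makes all the z_k^2 equal. *)
Lemma non_adj_meet v u P : (v < 24)%N -> (u < 24)%N -> v != u -> ~~ adj v u ->
  L v P -> L u P -> P = 0.
Proof.
move=> v24 u24 vu nadj hv hu.
have sgn k : (k < 3)%N -> zc v k P = (-1) ^+ (neg v k (+) neg u k) * zc u k P.
  by move=> k3; apply: (plane_signs k3 (proj1 hv) (proj1 hu)).
have eq0 k : (k < 3)%N -> sig u k = sig v k -> neg u k = ~~ neg v k -> zc v k P = 0.
  move=> k3 e1 e2; have := sgn k k3.
  rewrite e2 [zc u k P]/zc e1 -/(zc v k P) addbN addbb mulN1r => /eqP.
  by rewrite -addr_eq0 -mulr2n mulrn_eq0 => /eqP.
have sq k : (k < 3)%N -> zc v k P ^+ 2 = zc u k P ^+ 2.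
  by move=> k3; rewrite sgn // exprMn sqrr_sign mul1r.
case: (non_adj_cases v24 u24 vu nadj) => [[j j3 h]|[k k3 [h1 h2 h3 h4 h5]]|h|h].
- by case: j j3 h => [|[|[|//]]] _ h; [apply: (@line_pt0k v 0)|apply: (@line_pt0k v 1)|
    apply: (@line_pt0k v 2)] => //; rewrite /nx /nxx /=; apply: eq0;
      rewrite ?(proj1 (h _ _ _)) ?(proj2 (h _ _ _)).
- have x3 : (nx k < 3)%N /\ (nxx k < 3)%N by case: k k3 {h1 h2 h3 h4 h5} => [|[|[|]]].
  have z1 : zc v (nx k) P = 0.
    have := sgn _ x3.1; rewrite [zc u _ _]/zc h3 -/(zc v (nxx k) P).
    rewrite (sgn _ x3.2) [zc u _ _]/zc h4 -/(zc v (nx k) P) h5 mulrA -signr_addb.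
    rewrite addbN addbb mulN1r => /eqP.
    by rewrite -addr_eq0 -mulr2n mulrn_eq0 => /eqP.
  apply: (line_pt0k v24 k3 hv) => //.
  by rewrite (sgn _ x3.2) [zc u _ _]/zc h4 -/(zc v (nx k) P) z1 mulr0.
- have e k : (k < 3)%N -> zc v k P ^+ 2 = zc v (nx k) P ^+ 2.
    by move=> k3; rewrite sq // /zc h.
  by apply: (line_sqr_eq0 v24 hv); rewrite e.
- have e k : (k < 3)%N -> zc v k P ^+ 2 = zc v (nxx k) P ^+ 2.
    by move=> k3; rewrite sq // /zc h.
  by apply: (line_sqr_eq0 v24 hv); [rewrite [RHS]e|rewrite [RHS]e // e].
Qed.

(** This makes the combinatorial graph geometric, hence invariant under automorphisms that permute
    the lines. *)
Lemma adjP (v u : nat) : (v < 24)%N -> (u < 24)%N ->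
  reflect (v != u /\ exists P, [/\ P != 0, L v P & L u P]) (adj v u).
Proof.
move=> v24 u24; apply: (iffP idP) => [vu|[vu [P [P0 vP uP]]]].
  split; first by apply: contraTneq vu => ->; rewrite adj_irr.
  have /hasP[k] := vu; rewrite mem_iota => k3 vuk.
  exact: (adjk_meet k3 v24 u24 vuk).
apply: contraNT P0 => nadj; apply/eqP.
exact: (non_adj_meet v24 u24 vu nadj vP uP).
Qed.

Lemma line_basis v : (v < 24)%N -> exists B1 B2, [/\ L v B1, L v B2,
  forall s t, s *: B1 + t *: B2 = 0 -> s = 0 /\ t = 0 &
  forall P, L v P -> exists s t, P = s *: B1 + t *: B2].
Proof.
move=> v24; have d2 := d_neq0 v24 (isT : 2 < 3)%N.
have [|B1 L1 z1] := @line_pt v (nth 0 [:: d v 2; 0; - d v 0]) v24.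
  by rewrite /=; ring.
have [|B2 L2 z2] := @line_pt v (nth 0 [:: 0; d v 2; - d v 1]) v24.
  by rewrite /=; ring.
have z0E s t : zc v 0 (s *: B1 + t *: B2) = s * d v 2.
  by rewrite zcD !zcZ z1 // z2 //= mulr0 addr0.
have z1E s t : zc v 1 (s *: B1 + t *: B2) = t * d v 2.
  by rewrite zcD !zcZ z1 // z2 //= mulr0 add0r.
have zc0 k : zc v k 0 = 0 by rewrite /zc /coord mxE.
exists B1, B2; split=> // [s t h|P hP].
  move: (z0E s t) (z1E s t); rewrite h !zc0 => /esym/eqP + /esym/eqP.
  by rewrite !mulf_eq0 (negPf d2) !orbF => /eqP-> /eqP->.
exists (zc v 0 P / d v 2), (zc v 1 P / d v 2).
apply/eqP; rewrite -subr_eq0; apply/eqP; apply: (@line_pt0k v 2 _ v24 isT).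
- apply: in_lineD => //; rewrite -scaleN1r; apply: in_lineZ.
  by apply: in_lineD; apply: in_lineZ.
- by rewrite /nx /= zcD -scaleN1r zcZ z0E divfK // mulN1r subrr.
- by rewrite /nxx /= zcD -scaleN1r zcZ z1E divfK // mulN1r subrr.
Qed.

Lemma line_inj v u : (v < 24)%N -> (u < 24)%N -> (forall P, L v P -> L u P) -> v = u.
Proof.
move=> v24 u24 sub; apply/eqP/negPn/negP => vu.
have [B1 [B2 [L1 L2 ind _]]] := line_basis v24.
have B10 : B1 != 0.
  apply/eqP => B10; have [] := ind 1 0; first by rewrite B10 scaler0 scale0r addr0.
  by move/eqP; rewrite oner_eq0.
case: (boolP (adj v u)) => [/hasP[k]|nadj].
  rewrite mem_iota => k3 vuk.
  have [a B2E] := adjk_meet_uniq k3 v24 u24 vuk B10 L1 (sub _ L1) L2 (sub _ L2).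
  have [] := ind (- a) 1; first by rewrite B2E scale1r scaleNr addNr.
  by move=> _ /eqP; rewrite oner_eq0.
by move/eqP: B10; apply; apply: (non_adj_meet v24 u24 vu nadj L1 (sub _ L1)).
Qed.

End Incidence.

(** * Moduli of the lines and rigidity *)

Section Quadrics.
Variable C : numFieldType.
Implicit Types (f g : C * C).

(* A binary quadratic form vanishing at the two distinct zeros of
   g1 ^ 2 - g2 ^ 2 is a multiple of it. *)
Lemma quadric_multiple f1 f2 g1 g2 : brk g1 g2 != 0 ->
  (forall s t, ev g1 s t ^+ 2 = ev g2 s t ^+ 2 -> ev f1 s t ^+ 2 = ev f2 s t ^+ 2) ->
  exists a, forall s t,
    ev f1 s t ^+ 2 - ev f2 s t ^+ 2 = a * (ev g1 s t ^+ 2 - ev g2 s t ^+ 2).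
Proof.
move=> gN h; set D := brk g1 g2 in gN.
(* The zeros of g1 - g2 and of g1 + g2. Below, [B] is the polar form of f1^2 - f2^2 at these two
   points, the only coefficient that survives in the basis they form. *)
pose s1 := g1.2 - g2.2; pose t1 := g2.1 - g1.1.
pose s2 := g1.2 + g2.2; pose t2 := - (g1.1 + g2.1).
have h1 : ev f1 s1 t1 ^+ 2 - ev f2 s1 t1 ^+ 2 = 0.
  by apply/eqP; rewrite subr_eq0; apply/eqP/h; rewrite /ev /s1 /t1; ring.
have h2 : ev f1 s2 t2 ^+ 2 - ev f2 s2 t2 ^+ 2 = 0.
  by apply/eqP; rewrite subr_eq0; apply/eqP/h; rewrite /ev /s2 /t2; ring.
pose B := ev f1 s1 t1 * ev f1 s2 t2 - ev f2 s1 t1 * ev f2 s2 t2.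
have N4 : 4 != 0 :> C by rewrite pnatr_eq0.
exists (- 2 * B / (4 * D ^+ 2)) => s t.
have DN : 4 * D ^+ 2 != 0 by rewrite mulf_neq0 // expf_neq0.
apply: (mulfI DN); rewrite [RHS]mulrA [X in _ = X * _]mulrC divfK //.
transitivity ((ev g1 s t + ev g2 s t) ^+ 2 * (ev f1 s1 t1 ^+ 2 - ev f2 s1 t1 ^+ 2)
  + (ev g1 s t - ev g2 s t) ^+ 2 * (ev f1 s2 t2 ^+ 2 - ev f2 s2 t2 ^+ 2)
  - 2 * B * (ev g1 s t ^+ 2 - ev g2 s t ^+ 2)); last by rewrite h1 h2; ring.
by rewrite /B /D /brk /ev /s1 /t1 /s2 /t2; ring.
Qed.

(* Both sides are, up to the factor 4, discriminants. *)
Lemma quadric_disc f1 f2 g1 g2 a :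
  (forall s t, ev f1 s t ^+ 2 - ev f2 s t ^+ 2 = a * (ev g1 s t ^+ 2 - ev g2 s t ^+
    2)) ->
  brk f1 f2 ^+ 2 = a ^+ 2 * brk g1 g2 ^+ 2.
Proof.
move=> h; have N4 : 4 != 0 :> C by rewrite pnatr_eq0.
pose E x1 x2 s t : C := ev x1 s t ^+ 2 - ev x2 s t ^+ 2.
have discE x1 x2 : 4 * brk x1 x2 ^+ 2 =
    (E x1 x2 1 1 - E x1 x2 1 0 - E x1 x2 0 1) ^+ 2 - 4 * E x1 x2 1 0 * E x1 x2 0 1.
  by rewrite /E /ev /brk; ring.
apply: (mulfI N4); rewrite [RHS]mulrCA !discE /E !h.
by ring.
Qed.

End Quadrics.

Section Rigidity.
Variables (C : numClosedFieldType) (c : 'rV[C]_6).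
Hypothesis gen : generic c.
Implicit Types (P Q : 'cV[C]_6) (A : 'M[C]_6).
Local Notation d v k := (dlab c (lab v k)).
Local Notation L := (in_line c).

Lemma row_multiple (r : 'rV[C]_6) : c != 0 ->
  (forall P, in_hyperplane c P -> in_hyperplane r P) -> exists a, r = a *: c.
Proof.
move=> c0 h; have [j cj] : exists j, c 0 j != 0.
  apply/existsP; apply: contraNT c0 => /existsPn h0; apply/eqP/rowP => j.
  by rewrite mxE; apply/eqP/negPn/h0.
exists (r 0 j / c 0 j); apply/rowP => i; rewrite !mxE.
have sumE (x : 'rV[C]_6) (a b : C) : \sum_l x 0 l *
   (a *: delta_mx i 0 + b *: delta_mx j 0 : 'cV[C]_6) l 0 = a * x 0 i + b * x 0 j.
  have delta l : \sum_l' x 0 l' * (delta_mx l 0 : 'cV[C]_6) l' 0 = x 0 l.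
    rewrite (bigD1 l) //= big1 ?addr0 ?mxE ?eqxx ?mulr1 //.
    by move=> l' /negPf ll'; rewrite mxE ll' mulr0.
  rewrite -(delta i) -(delta j) !mulr_sumr -big_split /=.
  by apply: eq_bigr => l _; rewrite !mxE; ring.
(* This vector lies in R_c, and [r] vanishes on it only if the minor of [r] and [c] on columns [i]
   and [j] does. *)
have := h (c 0 j *: delta_mx i 0 + (- c 0 i) *: delta_mx j 0).
rewrite /in_hyperplane !sumE => /(_ _)/eqP e; apply: (mulfI cj).
have {}e : c 0 j * r 0 i + - c 0 i * r 0 j = 0 by apply: e; apply/eqP; ring.
move/eqP: e; rewrite mulNr subr_eq0 => /eqP ->.
by field.
Qed.

Lemma in_hyperplane_mul A P : in_hyperplane c (A *m P) = in_hyperplane (c *m A) P.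
Proof.
have E (x : 'rV[C]_6) (y : 'cV[C]_6) : \sum_i x 0 i * y i 0 = (x *m y) 0 0.
  by rewrite mxE.
by rewrite /in_hyperplane !E mulmxA.
Qed.

(** Only one inclusion is assumed, but it makes [c *m A] a multiple of [c], with a nonzero factor
    since [A] is invertible. *)
Lemma preserves_inv A : c != 0 -> preserves_hyperplane c A ->
  preserves_hyperplane c (invmx A).
Proof.
move=> c0 [Au hA]; split; first by rewrite unitmx_inv.
have [|a aE] := @row_multiple (c *m A) c0.
  by move=> P /hA; rewrite in_hyperplane_mul.
have a0 : a != 0.
  apply: contraNneq c0 => a0; have := mulmxK Au c.
  by rewrite aE a0 scale0r mul0mx => <-.
have cE : c *m invmx A = a^-1 *: c.
  by rewrite -[in LHS](scalerK a0 c) -aE -scalemxAl mulmxK.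
move=> P /eqP hP; rewrite in_hyperplane_mul cE; apply/eqP.
rewrite -[RHS](mulr0 a^-1) -[in RHS]hP mulr_sumr.
by apply: eq_bigr => i _; rewrite mxE mulrA.
Qed.

Lemma leaves_inv A : A \in unitmx -> preserves_hyperplane c (invmx A) ->
  leaves_X_invariant c A -> leaves_X_invariant c (invmx A).
Proof. by move=> Au [_ hi] hX P hP; rewrite -hX ?mulKVmx //; apply: hi. Qed.

Lemma line_image A : preserves_hyperplane c A -> leaves_X_invariant c A ->
  exists pi : 'I_24 -> 'I_24, forall (v : 'I_24) P, L v P -> L (pi v) (A *m P).
Proof.
move=> [Au hA] hX.
suff : forall v : 'I_24, exists w : 'I_24, forall P, L v P -> L w (A *m P).
  by move=> /fin_all_exists.
move=> v; have [B1 [B2 [L1 L2 ind span]]] := line_basis gen (ltn_ord v).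
have [|s t|w w24 [Lw1 Lw2]] := @lines_classification _ c (A *m B1) (A *m B2) gen.
- move=> s t h; apply: ind; rewrite -[LHS](mulKmx Au) mulmxDr -!scalemxAr h.
  by rewrite mulmx0.
- have Lst : L v (s *: B1 + t *: B2) by apply: in_lineD; apply: in_lineZ.
  rewrite !scalemxAr -mulmxDr hX ?(line_in_X (ltn_ord v) Lst) //.
  by case: Lst.
exists (Ordinal w24) => P /span[s [t ->]].
by rewrite mulmxDr -!scalemxAr; apply: in_lineD; apply: in_lineZ.
Qed.

(** The brackets are the entries of the cross product of two points of the line in the plane with
    coordinates z_k, and so are proportional to the coefficients of its equation. *)
Lemma line_brk v B1 B2 : (v < 24)%N -> L v B1 -> L v B2 ->
  (forall s t, s *: B1 + t *: B2 = 0 -> s = 0 /\ t = 0) ->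
  exists2 e : C, e != 0 & forall k, (k < 3)%N ->
    brk (zc v (nx k) B1, zc v (nx k) B2) (zc v (nxx k) B1, zc v (nxx k) B2) = e * d v k.
Proof.
move=> v24 L1 L2 ind; pose g k := (zc v k B1, zc v k B2).
have evE k s t : ev (g k) s t = zc v k (s *: B1 + t *: B2).
  by rewrite zcD !zcZ.
have Lst s t : L v (s *: B1 + t *: B2) by apply: in_lineD; apply: in_lineZ.
have d0 := d_neq0 gen v24.
have r1 := line_eq v24 L1; have r2 := line_eq v24 L2.
exists (brk (g 1%N) (g 2%N) / d v 0); last first.
  have e1 : d v 0 * brk (g 2%N) (g 0%N) = d v 1 * brk (g 1%N) (g 2%N).
    apply/eqP; rewrite -subr_eq0; apply/eqP; rewrite /brk /=.
    transitivity (zc v 2 B1 * (d v 0 * zc v 0 B2 + d v 1 * zc v 1 B2 +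
      d v 2 * zc v 2 B2)
      - zc v 2 B2 * (d v 0 * zc v 0 B1 + d v 1 * zc v 1 B1 + d v 2 * zc v 2 B1)).
      by ring.
    by rewrite r1 r2 !mulr0 subrr.
  have e2 : d v 0 * brk (g 0%N) (g 1%N) = d v 2 * brk (g 1%N) (g 2%N).
    apply/eqP; rewrite -subr_eq0; apply/eqP; rewrite /brk /=.
    transitivity (zc v 1 B2 * (d v 0 * zc v 0 B1 + d v 1 * zc v 1 B1 +
      d v 2 * zc v 2 B1)
      - zc v 1 B1 * (d v 0 * zc v 0 B2 + d v 1 * zc v 1 B2 + d v 2 * zc v 2 B2)).
      by ring.
    by rewrite r1 r2 !mulr0 subrr.
  case=> [|[|[|//]]] _; rewrite /nx /nxx /= -!/(g _).
  - by rewrite divfK // d0.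
  - by rewrite mulrAC [X in _ = X / _]mulrC -e1 mulrAC mulfV ?mul1r ?d0.
  - by rewrite mulrAC [X in _ = X / _]mulrC -e2 mulrAC mulfV ?mul1r ?d0.
rewrite mulf_neq0 ?invr_eq0 ?d0 //; apply/eqP => b0.
have zero s t : ev (g 1%N) s t = 0 -> ev (g 2%N) s t = 0 -> s = 0 /\ t = 0.
  rewrite !evE => z1 z2; apply: ind.
  exact: (@line_pt0k _ _ gen v 0 _ v24 isT (Lst s t)).
have g1 : g 1%N = (0, 0).
  have [||e1 e2] := zero (g 1%N).2 (- (g 1%N).1).
  - by rewrite /ev; ring.
  - by rewrite -[RHS]oppr0 -b0 /ev /brk; ring.
  by rewrite [g 1%N]surjective_pairing e1 -[(g 1%N).1]opprK e2 oppr0.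
have g2 : g 2%N = (0, 0).
  have [||e1 e2] := zero (g 2%N).2 (- (g 2%N).1).
  - by rewrite g1 /ev /= !mulr0 addr0.
  - by rewrite /ev; ring.
  by rewrite [g 2%N]surjective_pairing e1 -[(g 2%N).1]opprK e2 oppr0.
have [||/eqP] := zero 1 0.
- by rewrite g1 /ev /= !mulr0 addr0.
- by rewrite g2 /ev /= !mulr0 addr0.
by rewrite oner_eq0.
Qed.

(* The three quadratic forms z_a ^ 2 - z_b ^ 2 on L v sum to zero and have
   discriminants proportional to the d v k ^ 2. *)
Lemma line_moduli A (theta : nat -> nat) v w : A \in unitmx ->
  (v < 24)%N -> (w < 24)%N -> (forall P, L v P -> L w (A *m P)) ->
  (forall k, (k < 3)%N -> (theta k < 3)%N) ->
  (forall k l, (k < 3)%N -> (l < 3)%N -> theta k = theta l -> k = l) ->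
  (forall k P, (k < 3)%N -> L v P -> zc v (nx k) P ^+ 2 = zc v (nxx k) P ^+ 2 ->
    zc w (nx (theta k)) (A *m P) ^+ 2 = zc w (nxx (theta k)) (A *m P) ^+ 2) ->
  forall k l, (k < 3)%N -> (l < 3)%N ->
    d w (theta k) ^+ 2 * d v l ^+ 2 = d w (theta l) ^+ 2 * d v k ^+ 2.
Proof.
move=> Au v24 w24 hA th3 thI hq.
have [B1 [B2 [L1 L2 ind span]]] := line_basis gen v24.
pose g k := (zc v k B1, zc v k B2).
pose f k := (zc w k (A *m B1), zc w k (A *m B2)).
have gE k s t : ev (g k) s t = zc v k (s *: B1 + t *: B2) by rewrite zcD !zcZ.
have fE k s t : ev (f k) s t = zc w k (A *m (s *: B1 + t *: B2)).
  by rewrite mulmxDr -!scalemxAr zcD !zcZ.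
have Lst s t : L v (s *: B1 + t *: B2) by apply: in_lineD; apply: in_lineZ.
have [e e0 he] := line_brk v24 L1 L2 ind.
have [e' e'0 he'] : exists2 e' : C, e' != 0 & forall k, (k < 3)%N ->
    brk (f (nx k)) (f (nxx k)) = e' * d w k.
  apply: line_brk => //; try exact: hA.
  move=> s t h; apply: ind; rewrite -[LHS](mulKmx Au) mulmxDr -!scalemxAr h.
  by rewrite mulmx0.
pose G k s t := ev (g (nx k)) s t ^+ 2 - ev (g (nxx k)) s t ^+ 2.
pose F k s t := ev (f (nx k)) s t ^+ 2 - ev (f (nxx k)) s t ^+ 2.
have FG k : (k < 3)%N -> exists a, forall s t, F (theta k) s t = a * G k s t.
  move=> k3; apply: quadric_multiple; first by rewrite he // mulf_neq0 // (d_neq0 gen).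
  by move=> s t; rewrite !gE !fE; apply: hq.
have [a0 ha0] := FG 0%N isT; have [a1 ha1] := FG 1%N isT; have [a2 ha2] := FG 2%N isT.
have sumG s t : G 0%N s t + G 1%N s t + G 2%N s t = 0.
  by rewrite /G /nx /nxx /=; ring.
have sumF s t : F (theta 0%N) s t + F (theta 1%N) s t + F (theta 2%N) s t = 0.
  have [t0 t1 t2] : [/\ theta 0%N < 3, theta 1%N < 3 & theta 2%N < 3]%N by split;
    apply: th3.
  have t01 : theta 0%N <> theta 1%N by move/(thI 0%N 1%N isT isT).
  have t02 : theta 0%N <> theta 2%N by move/(thI 0%N 2%N isT isT).
  have t12 : theta 1%N <> theta 2%N by move/(thI 1%N 2%N isT isT).
  move: t0 t1 t2 t01 t02 t12; rewrite /F.
  case: (theta 0%N) => [|[|[|//]]] _; case: (theta 1%N) => [|[|[|//]]] _;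
  case: (theta 2%N) => [|[|[|//]]] _ //= _ _ _; rewrite /nx /nxx /=; ring.
(* The meeting point with a neighbour of kind [k]; if the next form vanished there too, all the
   z_k^2 would agree. Evaluating both zero sums at such points forces the factors [a0], [a1], [a2]
   to coincide. *)
have zeroG k : (k < 3)%N -> exists s t, G k s t = 0 /\ G (nx k) s t != 0.
  move=> k3; have [u [vu _]] := adjk_sign_ex false k3 v24.
  have [P [P0 vP uP]] := adjk_meet gen k3 v24 (ltn_ord u) vu.
  have [s [t PE]] := span P vP; exists s, t.
  have z0 : zc v (nx k) P ^+ 2 = zc v (nxx k) P ^+ 2.
    by apply/(sqr_zc_line k3 v24 vP); exists u.
  rewrite /G !gE -PE z0 subrr; split=> //; rewrite subr_eq0.
  apply: contraNneq P0 => z1; apply/eqP.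
  apply: (line_sqr_eq0 gen v24 vP); move: z0 z1;
    by case: k k3 {vu} => [|[|[|//]]] _; rewrite /nx /nxx /= => h1 h2;
    first [exact: h1 | exact: h2 | exact: (esym (etrans h1 h2))].
have a12 : a1 = a2.
  have [s [t [G0 G1]]] := zeroG 0%N isT; apply: (mulIf G1); rewrite -[nx 0]/1%N.
  have := sumG s t; rewrite G0 add0r addrC => /eqP; rewrite addr_eq0 => /eqP g2.
  have := sumF s t; rewrite ha0 ha1 ha2 G0 mulr0 add0r g2 mulrN => /eqP.
  by rewrite subr_eq0 => /eqP.
have a20 : a2 = a0.
  have [s [t [G1 G2]]] := zeroG 1%N isT; apply: (mulIf G2); rewrite -[nx 1]/2%N.
  have := sumG s t; rewrite G1 addr0 => /eqP; rewrite addr_eq0 => /eqP g0.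
  have := sumF s t; rewrite ha0 ha1 ha2 G1 mulr0 addr0 g0 mulrN addrC => /eqP.
  by rewrite subr_eq0 => /eqP.
have disc k : (k < 3)%N -> (e' * d w (theta k)) ^+ 2 = a0 ^+ 2 * (e * d v k) ^+ 2.
  move=> k3; rewrite -he' ?th3 // -he //; apply: quadric_disc => s t.
  rewrite -/(F (theta k) s t) -!/(g _) -/(G k s t).
  by case: k k3 => [|[|[|//]]] _; rewrite ?ha0 ?ha1 ?ha2 ?a12 ?a20.
move=> k l k3 l3; have e'2 : e' ^+ 2 != 0 by rewrite expf_neq0.
have := disc k k3; have := disc l l3; rewrite !exprMn => hl hk.
by apply: (mulfI e'2); rewrite [LHS]mulrA [RHS]mulrA hk hl; ring.
Qed.

(** A projective map of a line fixing three distinct points is the identity. The points are [R0] and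
    [R1], where z_0 = +- z_1, and [R2], where z_1 = z_2. *)
Lemma line_pointwise A : A \in unitmx -> forall v, (v < 24)%N ->
  (forall u P, (u < 24)%N -> L u P -> L u (A *m P)) ->
  exists a, forall P, L v P -> A *m P = a *: P.
Proof.
move=> Au v v24 hA.
have eigen k (s : bool) : (k < 3)%N -> exists P a, [/\ P != 0, L v P, A *m P = a *: P &
    zc v (nx k) P = (-1) ^+ s * zc v (nxx k) P].
  move=> k3; have [u [vu us]] := adjk_sign_ex s k3 v24.
  have [P [P0 vP uP]] := adjk_meet gen k3 v24 (ltn_ord u) vu.
  have [a aE] := adjk_meet_uniq gen k3 v24 (ltn_ord u) vu P0 vP uP
    (hA _ _ v24 vP) (hA _ _ (ltn_ord u) uP).
  by exists P, a; split=> //; have /(adjk_line k3 v24 (ltn_ord u) vu vP) := uP;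
    rewrite us.
have [R0 [a0 [R00 L0 A0]]] := eigen 2%N false isT.
have [R1 [a1 [R10 L1 A1]]] := eigen 2%N true isT.
have [R2 [a2 [R20 L2 A2]]] := eigen 0%N false isT.
rewrite /nx /nxx /= !mul1r mulN1r => e2 e1 e0.
have r0 : zc v 1 R0 != 0.
  apply: contraNneq R00 => z; apply/eqP; apply:
    (@line_pt0k _ _ gen v 2 _ v24 isT L0) => //.
  by rewrite /nx /= e0.
have r1 : zc v 1 R1 != 0.
  apply: contraNneq R10 => z; apply/eqP; apply:
    (@line_pt0k _ _ gen v 2 _ v24 isT L1) => //.
  by rewrite /nx /= e1 z oppr0.
have N2 : 2 != 0 :> C by rewrite pnatr_eq0.
pose al P := (zc v 0 P + zc v 1 P) / (2 * zc v 1 R0).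
pose be P := (zc v 1 P - zc v 0 P) / (2 * zc v 1 R1).
have spanE P : L v P -> P = al P *: R0 + be P *: R1.
  move=> hP; apply/eqP; rewrite -subr_eq0 -scaleN1r; apply/eqP.
  apply: (@line_pt0k _ _ gen v 2 _ v24 isT).
  - by do 2?apply: in_lineD => //; apply: in_lineZ => //; apply: in_lineD; apply:
    in_lineZ.
  - by rewrite /nx /= zcD !zcZ zcD !zcZ e0 e1 /al /be; field; apply/andP.
  - by rewrite /nxx /= zcD !zcZ zcD !zcZ /al /be; field; apply/andP.
have R2E := spanE _ L2.
(* [R2] differs from [R0] and [R1]: otherwise all three squares would agree on it. So both its
   coordinates in the basis [R0], [R1] are nonzero. *)
have sqN : zc v 0 R2 ^+ 2 != zc v 1 R2 ^+ 2.
  apply: contraNneq R20 => h; apply/eqP; apply: (line_sqr_eq0 gen v24 L2 h).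
  by rewrite e2.
have al0 : al R2 != 0.
  rewrite /al mulf_neq0 ?invr_eq0 ?mulf_neq0 //; apply: contraNneq sqN => /eqP.
  by rewrite addr_eq0 => /eqP ->; rewrite sqrrN.
have be0 : be R2 != 0.
  rewrite /be mulf_neq0 ?invr_eq0 ?mulf_neq0 //; apply: contraNneq sqN => /eqP.
  by rewrite subr_eq0 => /eqP ->.
have coef x y : x *: R0 + y *: R1 = 0 -> x = 0 /\ y = 0.
  move=> h; have z0 k : zc v k 0 = 0 :> C by rewrite /zc /Defs.coord mxE.
  have /eqP := z0 0%N; have /eqP := z0 1%N; rewrite -h !zcD !zcZ e0 e1.
  rewrite addr_eq0 => /eqP xE; rewrite xE mulrN -opprD oppr_eq0 -mulr2n mulrn_eq0.
  rewrite mulf_eq0 (negPf r1) orbF => /eqP y0; split=> //.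
  by move/eqP: xE; rewrite y0 mul0r oppr0 mulf_eq0 (negPf r0) orbF => /eqP.
move: (al R2) (be R2) R2E al0 be0 => x y R2E x0 y0.
have [] : x * (a0 - a2) = 0 /\ y * (a1 - a2) = 0.
  apply: coef; have := A2; rewrite R2E mulmxDr -!scalemxAr A0 A1 => h.
  rewrite !mulrBr !scalerBl addrACA -opprD -!scalerA h scalerDr.
  by rewrite !scalerA [a2 * x]mulrC [a2 * y]mulrC subrr.
move=> /eqP; rewrite mulf_eq0 (negPf x0) subr_eq0 => /eqP a02.
move=> /eqP; rewrite mulf_eq0 (negPf y0) subr_eq0 => /eqP a12.
exists a2 => P /spanE; move: (al P) (be P) => x' y' ->.
rewrite mulmxDr -!scalemxAr A0 A1 a02 a12 scalerDr !scalerA.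
by rewrite [a2 * x']mulrC [a2 * y']mulrC.
Qed.

(* The lines span the hyperplane: a linear form r vanishing on them all has
   dlab r p / dlab c p constant along each line, hence, the incidence graph
   being connected, altogether constant. *)
Lemma lines_span (r : 'rV[C]_6) :
  (forall (v : nat) P, (v < 24)%N -> L v P -> in_hyperplane r P) ->
  forall P, in_hyperplane c P -> in_hyperplane r P.
Proof.
move=> hr.
pose rho v k := dlab r (lab v k) / d v k.
have rhoE v k l : (v < 24)%N -> (k < 3)%N -> (l < 3)%N -> rho v k = rho v l.
  move=> v24 k3 l3; have [->//|kl] := eqVneq k l.
  (* The point of the line whose third coordinate vanishes; [r] vanishing there says that the two
     ratios agree. *)
  pose z j : C := if j == k then d v l else if j == l then - d v k else 0.
  have sumE (x : nat -> C) : x 0%N * z 0%N + x 1%N * z 1%N + x 2%N * z 2%N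
     = x k * d v l - x l * d v k.
    by rewrite /z; case: k l k3 l3 kl {z} => [|[|[|//]]] [|[|[|//]]] //= _ _ _; ring.
  have [|P hP zP] := @line_pt _ c v z v24.
    by rewrite (sumE (fun j => d v j)); ring.
  have /eqP := hr v P v24 hP; rewrite (in_hyperplane_plane r v24 (proj1 hP)).
  rewrite -!/(zc v _ P) !zP // (sumE (fun j => dlab r (lab v j))) => /eqP.
  by rewrite subr_eq0 => h; apply/eqP; rewrite /rho eqr_div ?(d_neq0 gen).
have adj_rho (v u : 'I_24) : adj v u -> rho v 0%N = rho u 0%N.
  move=> /hasP[k]; rewrite mem_iota => k3 vu.
  rewrite (rhoE v 0%N k) // (rhoE u 0%N k) //.
  by have [_ _ e _] := adjk_swap k3 (ltn_ord v) (ltn_ord u) vu; rewrite /rho e.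
have rho_const := @adj_connected _ (fun v => rho v 0%N) adj_rho.
pose a := rho 0%N 0%N.
have labE p : p \in labels -> dlab r p = a * dlab c p.
  case: p => [[k m] b] pl; have [k3 m3] := labels_lt pl.
  have [v <-] := lab_ex b k3 m3.
  have := rho_const v ord0; rewrite (rhoE v 0%N k) // -/a => <-.
  by rewrite /rho divfK // (d_neq0 gen).
have N2 : 2 != 0 :> C by rewrite pnatr_eq0.
have i0 : 'i != 0 :> C by exact: neq0Ci.
have coordE (k m : nat) : (k < 3)%N -> (m < 3)%N ->
    r 0 (inord (3 + m)) = a * c 0 (inord (3 + m)) /\ r 0 (inord k) = a * c 0 (inord k).
  move=> k3 m3.
  have := labE (k, m, true) (label_in_labels _ k3 m3).
  have := labE (k, m, false) (label_in_labels _ k3 m3).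
  rewrite /dlab expr0 expr1 /= => ef et; split.
    apply: (mulfI N2).
    transitivity ((r 0 (inord (3 + m)) + 1 * 'i * r 0 (inord k))
       + (r 0 (inord (3 + m)) + -1 * 'i * r 0 (inord k))); first by ring.
    by rewrite ef et; ring.
  apply: (mulfI N2); apply: (mulfI i0).
  transitivity ((r 0 (inord (3 + m)) + 1 * 'i * r 0 (inord k))
     - (r 0 (inord (3 + m)) + -1 * 'i * r 0 (inord k))); first by ring.
  by rewrite ef et; ring.
have rE i : r 0 i = a * c 0 i.
  rewrite -(inord_val i); case: (ltnP i 3) => i3.
    exact: (proj2 (coordE i 0%N i3 isT)).
  have i6 : (i - 3 < 3)%N by have := ltn_ord i; lia.
  by have := proj1 (coordE 0%N _ isT i6); rewrite subnKC.
move=> P /eqP hP; apply/eqP.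
transitivity (a * \sum_i c 0 i * P i 0); last by rewrite hP mulr0.
by rewrite mulr_sumr; apply: eq_bigr => i _; rewrite rE mulrA.
Qed.

Lemma lines_fixed A : c != 0 -> preserves_hyperplane c A -> leaves_X_invariant c A ->
  forall v P, (v < 24)%N -> L v P -> L v (A *m P).
Proof.
move=> c0 hA hX; have Au := proj1 hA; have hAi := preserves_inv c0 hA.
have [pi piP] := line_image hA hX.
have [pi' pi'P] := line_image hAi (leaves_inv Au hAi hX).
have piK : cancel pi pi'.
  move=> v; apply: val_inj; apply/esym; apply:
    (line_inj gen (ltn_ord _) (ltn_ord _)) => P hP.
  by rewrite -[P](mulKmx Au); apply/pi'P/piP.
have lift_pi (v : 'I_24) Q : L (pi v) Q -> exists2 P, L v P & Q = A *m P.
  by move=> /pi'P; rewrite piK => hQ; exists (invmx A *m Q); rewrite ?mulKVmx.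
have mulA0 P : (A *m P == 0) = (P == 0).
  apply/eqP/eqP => [h|->]; last by rewrite mulmx0.
  by rewrite -[P](mulKmx Au) h mulmx0.
have inj_pi := can_inj piK.
have adj_pi (v u : 'I_24) : adj (pi v) (pi u) = adj v u.
  apply/(adjP gen (ltn_ord _) (ltn_ord _))/(adjP gen (ltn_ord _) (ltn_ord _)).
    move=> [vu [Q [Q0 /lift_pi[P vP QP] uQ]]].
    split; first by apply: contraNneq vu => /val_inj ->.
    exists P; split=> //; first by rewrite -mulA0 -QP.
    have [P' uP' QP'] := lift_pi _ _ uQ.
    by rewrite -[P](mulKmx Au) -QP QP' (mulKmx Au).
  move=> [vu [P [P0 vP uP]]]; split.
    by apply: contraNneq vu => /val_inj/inj_pi ->.
  by exists (A *m P); rewrite mulA0; split=> //; apply: piP.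
suff pi_id (v : 'I_24) : pi v = v.
  by move=> v P v24 /(piP (Ordinal v24)); rewrite pi_id.
have [th [th3 thI thP]] := kind_aut inj_pi adj_pi v.
have mod := @line_moduli A th v (pi v) Au (ltn_ord v) (ltn_ord _) (piP v) th3 thI.
have {}mod k l : (k < 3)%N -> (l < 3)%N ->
    d (pi v) (th k) ^+ 2 * d v l ^+ 2 = d (pi v) (th l) ^+ 2 * d v k ^+ 2.
  apply: mod => {}k P k3 vP /(sqr_zc_line k3 (ltn_ord v) vP) [u [vu uP]].
  apply/(sqr_zc_line (th3 k k3) (ltn_ord _) (piP _ _ vP)).
  by exists (pi u); split; [apply: thP|apply: piP].
(* A label records its place, so equality forces [th k = k] along with equal [sig] and [neg]. Any
   mismatch contradicts the last condition of [generic], applied to the labels at [k] and at a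
   second place [l]. *)
have labE k : (k < 3)%N -> lab v k = lab (pi v) (th k).
  move=> k3; have [_ _ _ gen4] := gen.
  have [l l3 kl] : exists2 l, (l < 3)%N & l != k.
    by case: k k3 => [|k] _; [exists 1%N|exists 0%N].
  apply/eqP/negPn/negP => neq; have /eqP := mod k l k3 l3; apply/negP.
  rewrite mulrC; apply: gen4; rewrite ?lab_in ?th3 //.
    by rewrite /lab !xpair_eqE (negPf kl).
  by rewrite xpair_eqE (negPf neq) andbF.
have e k : (k < 3)%N -> sig (pi v) k = sig v k /\ neg (pi v) k = neg v k.
  by move=> k3; have [<- -> ->] := labE k k3.
apply: val_inj; apply: (line_inj gen (ltn_ord _) (ltn_ord _)) => P [hP cP]; split=>
  // k k3.
by have [<- <-] := e k k3; apply: hP.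
Qed.

Lemma generic_rigid A : c != 0 -> preserves_hyperplane c A ->
  leaves_X_invariant c A -> trivial_on_hyperplane c A.
Proof.
move=> c0 hA hX; have fixL := lines_fixed c0 hA hX; have Au := proj1 hA.
have [lam lamP] : exists lam : 'I_24 -> C, forall v : 'I_24, forall P, L v P ->
  A *m P = lam v *: P.
  suff : forall v : 'I_24, exists a, forall P, L v P -> A *m P = a *: P.
    by move=> /fin_all_exists.
  by move=> v; apply: (line_pointwise Au (ltn_ord v)) => u P; apply: fixL.
have lam_const : forall v u, lam v = lam u.
  apply: adj_connected => v u /(adjP gen (ltn_ord v) (ltn_ord u))[_ [P [P0 vP uP]]].
  apply/eqP; rewrite -subr_eq0; apply: contraNT P0 => h.
  rewrite -(inj_eq (scalerI h)) scaler0 scalerBl -lamP // -lamP //.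
  by rewrite subrr.
exists (lam ord0) => P hP; apply/eqP; rewrite -subr_eq0; apply/eqP/colP => i.
(* Each row of [M] is a linear form vanishing on all the lines, hence on R_c. *)
pose M := A - (lam ord0)%:M.
have ME Q : A *m Q - lam ord0 *: Q = M *m Q by rewrite mulmxBl mul_scalar_mx.
have rowE Q : \sum_j (row i M) 0 j * Q j 0 = (M *m Q) i 0.
  by rewrite mxE; apply: eq_bigr => j _; rewrite mxE.
rewrite ME mxE; have : in_hyperplane (row i M) P.
  apply: lines_span hP => v Q v24 vQ; rewrite /in_hyperplane rowE -ME.
  by rewrite (lamP (Ordinal v24)) // (lam_const _ ord0) subrr mxE.
by rewrite /in_hyperplane rowE mxE => /eqP ->; rewrite mxE.
Qed.

End Rigidity.

Unset Implicit Arguments.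

Theorem theorem5p2 (C : numClosedFieldType) :
  exists (d : nat) (P : {mpoly C[6]}),
    P != 0 /\ P \is d.-homog /\
    forall c : 'rV[C]_6, c != 0 -> P.@[fun i => c 0 i] != 0 ->
      forall A : 'M[C]_6,
        preserves_hyperplane c A -> leaves_X_invariant c A ->
        trivial_on_hyperplane c A.
Proof.
have [d [P [P0 Phom Pgen]]] := generic_polynomial C.
exists d, P; split=> //; split=> // c c0 /Pgen gen A.
exact: generic_rigid.
Qed.
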